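(* Let $(g,\nabla)$ be a statistical structure on a manifold $M$ and let $\tilde g$ be the Sasakian metric on $TM$ determined by $g$ and $\nabla$. If $\nabla$ is not flat, then the sectional curvature of $\tilde g$ on $TM$ is unbounded from above and from below. Moreover, if $\nabla$ is not flat, then the scalar curvature of $\tilde g$ is unbounded from below on $TM$.
   Context: All objects are smooth. A statistical structure on a manifold $M$ is a pair $(g,\nabla)$, where $g$ is a (positive definite) Riemannian metric and $\nabla$ is a torsion-free affine connection such that $(\nabla_Xg)(Y,Z)=(\nabla_Yg)(X,Z)$ for all $X,Y,Z$. The connection $\nabla$ is flat if its curvature tensor $R$ vanishes identically. Let $\pi:TM\to M$ be the tangent bundle. For $\xi,X\in T_pM$: the vertical lift $X^v_\xi\in T_\xi TM$ is the velocity at $t=0$ of the curve $t\mapsto \xi+tX$; the horizontal lift $X^h_\xi\in T_\xi TM$ is the velocity at $t=0$ of the curve $t\mapsto\xi_t$ obtained by $\nabla$-parallel transport of $\xi$ along the $\nabla$-geodesic with initial velocity $X$. One has $T_\xi TM=\{X^v_\xi\}\oplus\{X^h_\xi\}$, both lifts being linear and injective in $X$. The Sasakian metric $\tilde g$ determined by $g$ and $\nabla$ is the Riemannian metric on $TM$ with $\tilde g(X^v,Y^v)=g(X,Y)=\tilde g(X^h,Y^h)$ and $\tilde g(X^v,Y^h)=0$. *)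

(* Defs.v *)
From HB Require Import structures.
From mathcomp Require Import all_boot all_order all_algebra.
From mathcomp Require Import interval_inference.
From mathcomp Require Import all_classical all_reals topology normedtype landau derive.

Set Implicit Arguments.
Unset Strict Implicit.
Unset Printing Implicit Defensive.

Import Order.TTheory GRing.Theory Num.Theory.
Import numFieldNormedType.Exports.

Local Open Scope classical_set_scope.
Local Open Scope ring_scope.

Section Smooth.
Context {R : realType}.
Implicit Types V W : normedModType R.

Fixpoint diff_upto V W (k : nat) (U : set V) (f : V -> W) : Prop :=
  (forall x, U x -> differentiable f x) /\
  (if k is k'.+1 then forall v, diff_upto k' U ('D_v f) else True).

Definition smooth_on V W (U : set V) (f : V -> W) : Prop :=
  forall k, diff_upto k U f.

Lemma differentiable_near_eq V W (f g : V -> W) (x : V) :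
  (\near x, f x = g x) -> differentiable f x -> differentiable g x.
Proof.
move=> fg df; pose e := g - f.
have ez : \near x, e x = 0.
  by near=> y; rewrite /e !fctE (_ : f y = g y) ?subrr//; near: y.
suff de : differentiable e x.
  have -> : g = f + e by rewrite /e addrC subrK.
  exact: differentiableD.
have c0 : continuous (0 : V -> W) by move=> ?; exact: cvg_cst.
have ee : e \o shift x = cst (e x) + \0 +o_ (0 : V) id.
  apply/eqaddoP => _/posnumP[eps].
  have ez0 : \forall y \near (0 : V), e (y + x) = 0.
    have := ez; rewrite (near_shift 0 x) /=.
    by apply: filterS => y; rewrite /= subr0.
  near=> y.
  have -> : (e \o shift x - (cst (e x) + \0)) y = 0.
    rewrite !fctE /= (nbhs_singleton ez).
    rewrite (_ : e (y + x) = 0); last by near: y.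
    by rewrite addr0 subr0.
  by rewrite normr0 mulr_ge0.
have de0 : 'd e x = 0 :> (V -> W) by exact/diff_unique.
by apply/diff_locallyP; rewrite de0; split.
Unshelve. all: by end_near. Qed.


Lemma diff_upto_ext V W k (U : set V) (f g : V -> W) : open U ->
  (forall x, U x -> f x = g x) -> diff_upto k U f -> diff_upto k U g.
Proof.
move=> oU; have nU x : U x -> \near x, U x by move=> Ux; exact: open_nbhs_nbhs.
elim: k f g => [|k IH] f g fg /= [df Df]; split => //.
- by move=> x Ux; apply: (differentiable_near_eq _ (df _ Ux)); apply: filterS (nU _ Ux).
- by move=> x Ux; apply: (differentiable_near_eq _ (df _ Ux)); apply: filterS (nU _ Ux).
- move=> v; apply: IH (Df v) => x Ux; apply: near_eq_derive.
  exact: filterS (nU _ Ux).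
Qed.

Lemma diff_upto_diff V W k (U : set V) (f : V -> W) x :
  diff_upto k U f -> U x -> differentiable f x.
Proof. by case: k => [|k] [df _]; exact: df. Qed.

Lemma diff_uptoW V W k (U : set V) (f : V -> W) :
  diff_upto k.+1 U f -> diff_upto k U f.
Proof.
elim: k f => [|k IH] f; first by move=> [df _]; split.
by move=> [df Df]; split => // v; apply: IH; exact: Df.
Qed.

Lemma diff_upto_sub V W k (U U' : set V) (f : V -> W) :
  U' `<=` U -> diff_upto k U f -> diff_upto k U' f.
Proof.
move=> U'U; elim: k f => [|k IH] f [df Df]; split => //.
- by move=> x /U'U; exact: df.
- by move=> x /U'U; exact: df.
- by move=> v; apply: IH; exact: Df.
Qed.

Lemma diff_upto_comp_lin V V' W k (U : set V) (L : {linear V' -> V})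
    (f : V -> W) : open U -> continuous L ->
  diff_upto k U f -> diff_upto k (L @^-1` U) (f \o L).
Proof.
move=> oU cL; have oU' : open (L @^-1` U) by apply: open_comp => // x _; exact: cL.
have dL x : differentiable L x by exact: linear_differentiable.
elim: k f => [|k IH] f [df Df]; split => //.
- by move=> x Ux; apply: differentiable_comp => //; exact: df.
- by move=> x Ux; apply: differentiable_comp => //; exact: df.
- move=> v; apply: diff_upto_ext oU' _ (IH _ (Df (L v))) => x Ux /=.
  have dfx : differentiable f (L x) by exact: df.
  have dfLx : differentiable (f \o L) x by exact: differentiable_comp.
  rewrite (deriveE _ dfx) (deriveE _ dfLx) (diff_comp (dL x) dfx) /=.
  by have := diff_lin x cL => /= ->.
Qed.

Lemma diff_upto_cst V W k (U : set V) (a : W) : diff_upto k U (cst a).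
Proof.
elim: k a => [|k IH] a;
  (split; first by move=> x _; exact: differentiable_cst) => // v.
have -> : 'D_v (cst a) = (cst 0 : V -> W).
  by apply/funext => x; rewrite derive_cst.
exact: IH.
Qed.

Lemma diff_upto_lin V W k (U : set V) (L : {linear V -> W}) :
  continuous L -> diff_upto k U L.
Proof.
move=> cL; have dL x : differentiable L x by exact: linear_differentiable.
case: k => [|k]; split => // v.
have -> : 'D_v L = (cst (L v) : V -> W).
  by apply/funext => x; rewrite (deriveE _ (dL x)); have := diff_lin x cL => /= ->.
exact: diff_upto_cst.
Qed.

Lemma diff_uptoD V W k (U : set V) (f g : V -> W) : open U ->
  diff_upto k U f -> diff_upto k U g -> diff_upto k U (f + g).
Proof.
move=> oU; elim: k f g => [|k IH] f g [df Df] [dg Dg];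
  (split; first by move=> x Ux; apply: differentiableD; [exact: df|exact: dg]).
- exact: I.
- move=> v; apply: diff_upto_ext oU _ (IH _ _ (Df v) (Dg v)).
  move=> x Ux; rewrite deriveD//; apply: diff_derivable; [exact: df|exact: dg].
Qed.

Lemma diff_upto_sum V W k (U : set V) n (f : 'I_n -> V -> W) : open U ->
  (forall i, diff_upto k U (f i)) -> diff_upto k U (\sum_(i < n) f i).
Proof.
move=> oU df; elim/big_ind : _ => //.
- exact: (diff_upto_cst _ _ 0).
- by move=> ? ? ? ?; exact: diff_uptoD.
Qed.

Lemma diff_uptoM V k (U : set V) (f g : V -> R) : open U ->
  diff_upto k U f -> diff_upto k U g -> diff_upto k U (f * g).
Proof.
move=> oU; elim: k f g => [|k IH] f g hf hg;
  have [df Df] := hf; have [dg Dg] := hg;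
  (split; first by move=> x Ux; apply: differentiableM; [exact: df|exact: dg]).
- exact: I.
- move=> v; have := diff_uptoD oU (IH _ _ (diff_uptoW hf) (Dg v))
                                   (IH _ _ (diff_uptoW hg) (Df v)).
  apply: diff_upto_ext oU _.
  move=> x Ux; rewrite deriveM//; apply: diff_derivable; [exact: df|exact: dg].
Qed.

Lemma diff_upto_rV V k (U : set V) n (F : V -> 'rV[R]_n) : open U ->
  (forall j, diff_upto k U (fun x => F x 0 j)) -> diff_upto k U F.
Proof.
move=> oU; elim: k F => [|k IH] F hF.
  split => // x Ux.
  have -> : F = \sum_(j < n) (fun y => F y 0 j *: delta_mx 0 j).
    by apply/funext => y; rewrite fct_sumE [LHS]row_sum_delta.
  by apply: differentiable_sum => j; apply: differentiableZl; apply: (hF j).1.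
have dF x : U x -> differentiable F x.
  apply: (@diff_upto_diff _ _ k); apply: IH => j; exact: diff_uptoW.
split => // v; apply: IH => j; apply: (diff_upto_ext _ _ ((hF j).2 v)) => // x Ux.
by rewrite derive_mx ?mxE//; apply: diff_derivable; exact: dF.
Qed.

Lemma diff_upto_coord V k (U : set V) n (F : V -> 'rV[R]_n) j : open U ->
  diff_upto k U F -> diff_upto k U (fun x => F x 0 j).
Proof.
move=> oU; elim: k F => [|k IH] F [dF DF].
  split => // x Ux; apply: (@differentiable_comp _ _ _ _ F (fun M : 'rV_n => M 0 j)).
    exact: dF.
  exact: differentiable_coord.
split.
  have dFk : diff_upto k U F by exact: diff_uptoW (conj dF DF).
  by move=> x; apply: diff_upto_diff (IH _ dFk).
move=> v; apply: (diff_upto_ext _ _ (IH _ (DF v))) => // x Ux.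
by rewrite derive_mx ?mxE//; apply: diff_derivable; exact: dF.
Qed.

End Smooth.

(* The topology of the underlying set is the one induced by the charts, see
   atlas_open. `param i` inverts `coord i` on the image of the chart and is
   unconstrained elsewhere. *)
Record smooth_atlas (R : realType) (n : nat) := SmoothAtlas {
  point :> Type;
  chart : Type;
  dom : chart -> set point;
  coord : chart -> point -> 'rV[R]_n;
  param : chart -> 'rV[R]_n -> point;
  coordK : forall i p, dom i p -> param i (coord i p) = p;
  dom_cover : forall p, exists i, dom i p;
  open_overlap : forall i j, open (coord i @` (dom i `&` dom j));
  smooth_overlap : forall i j,
    smooth_on (coord i @` (dom i `&` dom j)) (coord j \o param i)
}.

Arguments open_overlap {R n} s i j.
Arguments smooth_overlap {R n} s i j k.

Section Atlas.
Context {R : realType} {n : nat} {N : smooth_atlas R n}.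
Implicit Types (i j : chart N) (p q : N).

Definition trans i j : 'rV[R]_n -> 'rV[R]_n := coord j \o param i.

Definition dtrans i j p (u : 'rV[R]_n) : 'rV[R]_n := 'D_u (trans i j) (coord i p).

Definition chart_image i : set 'rV[R]_n := coord i @` dom i.

Definition atlas_open (A : set N) : Prop :=
  forall i, open (coord i @` (dom i `&` A)).

Lemma chart_imageP i x : chart_image i x <->
  dom i (param i x) /\ coord i (param i x) = x.
Proof.
split=> [[p ip <-]|[ip xE]]; last by exists (param i x).
by rewrite coordK.
Qed.

Lemma open_chart_image i : open (chart_image i).
Proof. by have := open_overlap N i i; rewrite setIid. Qed.

Lemma trans_coord i j p : dom i p -> trans i j (coord i p) = coord j p.
Proof. by move=> ip; rewrite /trans /= coordK. Qed.

Lemma near_dom i j p : dom i p -> dom j p ->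
  \forall x \near coord i p, [/\ dom i (param i x), dom j (param i x) &
    coord i (param i x) = x].
Proof.
move=> ip jp; have : nbhs (coord i p) (coord i @` (dom i `&` dom j)).
  by apply: open_nbhs_nbhs; split; [exact: (open_overlap N)|exists p].
by apply: filterS => _ [q [iq jq] <-]; rewrite coordK.
Qed.

Lemma differentiable_trans i j p : dom i p -> dom j p ->
  differentiable (trans i j) (coord i p).
Proof.
move=> ip jp; apply: (diff_upto_diff (smooth_overlap N i j 0)).
by exists p.
Qed.

Lemma dtransE i j p u : dom i p -> dom j p ->
  dtrans i j p u = 'd (trans i j) (coord i p) u.
Proof. by move=> ip jp; rewrite /dtrans deriveE//; exact: differentiable_trans. Qed.

Lemma dtrans_id i p u : dom i p -> dtrans i i p u = u.
Proof.
move=> ip; rewrite /dtrans (@near_eq_derive _ _ _ _ id) ?derive_id//.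
by apply: filterS (near_dom ip ip) => x [].
Qed.

Lemma dtrans_comp i j k p u : dom i p -> dom j p -> dom k p ->
  dtrans j k p (dtrans i j p u) = dtrans i k p u.
Proof.
move=> ip jp kp.
have dij := differentiable_trans ip jp.
have djk := differentiable_trans jp kp.
rewrite (dtransE _ ip jp) (dtransE _ jp kp) -(trans_coord j ip) in djk *.
have := diff_comp dij djk => /(congr1 (fun h => h u)) /= <-.
rewrite -(deriveE _ (differentiable_comp dij djk)).
apply: near_eq_derive; apply: filterS (near_dom ip jp) => x [ix jx xE] /=.
by rewrite /trans /= coordK.
Qed.

End Atlas.

Record manifold (R : realType) (n : nat) := Manifold {
  manifold_atlas :> smooth_atlas R n;
  manifold_hausdorff : forall p q : manifold_atlas, p <> q ->
    exists A B : set manifold_atlas,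
      [/\ atlas_open A, atlas_open B, A p, B q & A `&` B = set0];
  manifold_second_countable : exists2 B : set (set manifold_atlas), countable B &
    B `<=` @atlas_open _ _ manifold_atlas /\
    forall (A : set manifold_atlas) p, atlas_open A -> A p ->
      exists2 b, B b & b p /\ b `<=` A
}.

Section TangentBundle.
Context {R : realType} {n : nat} (N : smooth_atlas R n).

(* A tangent vector is given by its components in all the charts around its base
   point; the components in the other charts are set to 0, so that two tangent
   vectors are equal as soon as they have the same components in one chart. *)
Record tangent := Tangent {
  base : N;
  comp : chart N -> 'rV[R]_n;
  comp_out : forall i, ~ dom i base -> comp i = 0;
  comp_trans : forall i j, dom i base -> dom j base ->
    comp j = dtrans i j base (comp i)
}.

Lemma tangent_eq (t s : tangent) : base t = base s -> comp t = comp s -> t = s.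
Proof.
case: t s => [p v o c] [q w o' c'] /= pq vw; subst q w.
by congr Tangent; exact: Prop_irrelevance.
Qed.

Definition mk_comp i (p : N) (y : 'rV[R]_n) (j : chart N) : 'rV[R]_n :=
  if `[< dom i p /\ dom j p >] then dtrans i j p y else 0.

Lemma mk_comp_out i p y j : ~ dom j p -> mk_comp i p y j = 0.
Proof. by move=> jp; rewrite /mk_comp asboolF// => -[]. Qed.

Lemma mk_comp_trans i p y j k : dom j p -> dom k p ->
  mk_comp i p y k = dtrans j k p (mk_comp i p y j).
Proof.
move=> jp kp; rewrite /mk_comp; have [ip|ip] := pselect (dom i p).
  by rewrite (asboolT (conj ip jp)) (asboolT (conj ip kp)) dtrans_comp.
by rewrite !asboolF ?/dtrans ?derive0// => -[].
Qed.

Definition mk_tangent i (p : N) (y : 'rV[R]_n) : tangent :=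
  Tangent (@mk_comp_out i p y) (@mk_comp_trans i p y).

Definition tdom (i : chart N) : set tangent := [set t | dom i (base t)].

Definition tcoord (i : chart N) (t : tangent) : 'rV[R]_(n + n) :=
  row_mx (coord i (base t)) (comp t i).

Definition tparam (i : chart N) (z : 'rV[R]_(n + n)) : tangent :=
  mk_tangent i (param i (lsubmx z)) (rsubmx z).

Lemma tcoordK i t : tdom i t -> tparam i (tcoord i t) = t.
Proof.
move=> it; have bE : param i (coord i (base t)) = base t by exact: coordK.
apply: tangent_eq; rewrite /= row_mxKl ?row_mxKr bE//.
apply/funext => j; rewrite /mk_comp; case: asboolP => [[_ jt]|njt].
  by rewrite -comp_trans.
by rewrite comp_out// => jt; exact: njt.
Qed.

Lemma tdom_cover t : exists i, tdom i t.
Proof. exact: dom_cover. Qed.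

Lemma timageE i j : tcoord i @` (tdom i `&` tdom j) =
  lsubmx @^-1` (coord i @` (dom i `&` dom j)).
Proof.
apply/seteqP; split=> [_ [t [it jt] <-]|z [p [ip jp] pz]] /=.
  by rewrite row_mxKl; exists (base t).
exists (mk_tangent i p (rsubmx z)) => //=.
by rewrite /tcoord /= /mk_comp (asboolT (conj ip ip)) dtrans_id// pz hsubmxK.
Qed.

Lemma topen_overlap i j : open (tcoord i @` (tdom i `&` tdom j)).
Proof.
rewrite timageE; apply: open_comp; last exact: (open_overlap N).
by move=> z _; exact: continuous_lsubmx.
Qed.

Lemma tsmooth_overlap i j :
  smooth_on (tcoord i @` (tdom i `&` tdom j)) (tcoord j \o tparam i).
Proof.
move=> k; set O := coord i @` (dom i `&` dom j).
have oO : open O by exact: (open_overlap N).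
have oT : open (lsubmx @^-1` O : set 'rV[R]_(n + n)).
  by rewrite -timageE; exact: topen_overlap.
have cl : continuous (lsubmx : 'rV[R]_(n + n) -> 'rV[R]_n).
  by move=> z; exact: continuous_lsubmx.
have cr : continuous (rsubmx : 'rV[R]_(n + n) -> 'rV[R]_n).
  by move=> z; exact: continuous_rsubmx.
have sO := smooth_overlap N i j; rewrite -/O -/(trans i j) in sO.
pose G (z : 'rV[R]_(n + n)) : 'rV[R]_(n + n) :=
  row_mx (trans i j (lsubmx z)) ('D_(rsubmx z) (trans i j) (lsubmx z)).
rewrite timageE -/O; apply: (@diff_upto_ext _ _ _ _ _ G) => //.
  move=> z [p [ip jp] pz]; rewrite /G /tcoord /= -pz coordK// trans_coord//.
  by rewrite /mk_comp (asboolT (conj ip jp)).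
apply: diff_upto_rV => // l; case: (split_ordP l) => m ->.
  have := diff_upto_coord m oT (diff_upto_comp_lin oO cl (sO k)).
  by apply: diff_upto_ext oT _ => z _ /=; rewrite row_mxEl.
have hsum : diff_upto k (lsubmx @^-1` O : set 'rV[R]_(n + n))
  (\sum_(a < n) ((fun z : 'rV[R]_(n + n) => rsubmx z 0 a) *
    (fun z : 'rV[R]_(n + n) => ('D_(delta_mx 0 a) (trans i j) \o lsubmx) z 0 m))).
  apply: diff_upto_sum => // a; apply: diff_uptoM => //.
    exact: (diff_upto_coord a oT (diff_upto_lin _ _ cr)).
  exact: (diff_upto_coord m oT (diff_upto_comp_lin oO cl ((sO k.+1).2 _))).
apply: diff_upto_ext oT _ hsum => z Oz; rewrite fct_sumE row_mxEr.
have dz : differentiable (trans i j) (lsubmx z) by exact: (sO 0).1.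
rewrite deriveE// [in RHS](row_sum_delta (rsubmx z)) linear_sum summxE.
by apply: eq_bigr => a _; rewrite linearZ /= mxE -deriveE.
Qed.

Definition tangent_bundle : smooth_atlas R (n + n) :=
  SmoothAtlas tcoordK tdom_cover topen_overlap tsmooth_overlap.

End TangentBundle.

Section Local.
Context {R : realType} {n : nat}.
Local Notation V := 'rV[R]_n.
Implicit Types (h : V -> 'M[R]_n) (G : 'I_n -> V -> 'M[R]_n) (X Y Z : V -> V).

Definition pairing (A : 'M[R]_n) (u v : V) : R := (u *m A *m v^T) 0 0.

(* `G k x a b` is the Christoffel symbol of upper index k and lower indices a, b
   at x; connection_vec is the bilinear map that it defines. *)
Definition connection_vec G (x u v : V) : V := \row_k pairing (G k x) u v.

Definition cov G X Y (x : V) : V := 'D_(X x) Y x + connection_vec G x (X x) (Y x).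

Definition cov_along G (c Y : R -> V) (t : R) : V :=
  derive1 Y t + connection_vec G (c t) (derive1 c t) (Y t).

Definition lie X Y (x : V) : V := 'D_(X x) Y x - 'D_(Y x) X x.

Definition torsion G X Y (x : V) : V := cov G X Y x - cov G Y X x - lie X Y x.

Definition curvature G X Y Z (x : V) : V :=
  cov G X (cov G Y Z) x - cov G Y (cov G X Z) x - cov G (lie X Y) Z x.

Definition cov_metric G h X Y Z (x : V) : R :=
  'D_(X x) (fun y => pairing (h y) (Y y) (Z y)) x
  - pairing (h x) (cov G X Y x) (Z x) - pairing (h x) (Y x) (cov G X Z x).

(* torsion, curvature and cov_metric are linear over smooth functions in each
   vector field, hence their values on tangent vectors at x may be computed with
   the extensions of these vectors by constant coordinate fields. *)
Definition torsion_at G (x u v : V) : V := torsion G (cst u) (cst v) x.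

Definition curvature_at G (x u v w : V) : V :=
  curvature G (cst u) (cst v) (cst w) x.

Definition cov_metric_at G h (x u v w : V) : R :=
  cov_metric G h (cst u) (cst v) (cst w) x.

Definition levi_civita h (k : 'I_n) (x : V) : 'M[R]_n := \matrix_(a, b)
  (2^-1 * \sum_l invmx (h x) k l *
     ('D_(delta_mx 0 a) (fun y => h y b l) x + 'D_(delta_mx 0 b) (fun y => h y a l) x
      - 'D_(delta_mx 0 l) (fun y => h y a b) x)).

Definition sectional h (x u v : V) : R :=
  pairing (h x) (curvature_at (levi_civita h) x u v v) u /
  (pairing (h x) u u * pairing (h x) v v - pairing (h x) u v ^+ 2).

Definition ricci h (x v w : V) : R :=
  \sum_c curvature_at (levi_civita h) x (delta_mx 0 c) v w 0 c.

Definition scalar h (x : V) : R := \sum_a \sum_b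
  invmx (h x) a b * ricci h x (delta_mx 0 a) (delta_mx 0 b).

End Local.

Record metric (R : realType) (n : nat) (N : smooth_atlas R n) := Metric {
  gmx :> chart N -> 'rV[R]_n -> 'M[R]_n;
  gmx_smooth : forall i, smooth_on (chart_image i) (gmx i);
  gmx_sym : forall i p, dom i p -> (gmx i (coord i p))^T = gmx i (coord i p);
  gmx_pos : forall i p u, dom i p -> u != 0 ->
    0 < pairing (gmx i (coord i p)) u u;
  gmx_trans : forall i j p u v, dom i p -> dom j p ->
    pairing (gmx j (coord j p)) (dtrans i j p u) (dtrans i j p v) =
    pairing (gmx i (coord i p)) u v
}.

Record connection (R : realType) (n : nat) (N : smooth_atlas R n) := Connection {
  chr :> chart N -> 'I_n -> 'rV[R]_n -> 'M[R]_n;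
  chr_smooth : forall i k, smooth_on (chart_image i) (chr i k);
  chr_trans : forall i j p u v, dom i p -> dom j p ->
    connection_vec (chr j) (coord j p) (dtrans i j p u) (dtrans i j p v) =
    dtrans i j p (connection_vec (chr i) (coord i p) u v)
    - 'D_u ('D_v (trans i j)) (coord i p)
}.

Section Geometry.
Context {R : realType} {n : nat} {N : smooth_atlas R n}.
Implicit Types (g : metric N) (nabla : connection N).

Definition torsion_free nabla : Prop := forall i p u v, dom i p ->
  torsion_at (nabla i) (coord i p) u v = 0.

Definition statistical g nabla : Prop := torsion_free nabla /\
  forall i p u v w, dom i p ->
    cov_metric_at (nabla i) (g i) (coord i p) u v w =
    cov_metric_at (nabla i) (g i) (coord i p) v u w.

Definition flat nabla : Prop := forall i p u v w, dom i p ->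
  curvature_at (nabla i) (coord i p) u v w = 0.

Definition sectional_curvatures g : set R := [set K | exists i p u v,
  [/\ dom i p, row_free (col_mx u v) & K = sectional (g i) (coord i p) u v]].

Definition scalar_curvatures g : set R := [set S | exists i p,
  dom i p /\ S = scalar (g i) (coord i p)].

(* The lifts are represented by their components in the chart `i` of the tangent
   bundle. *)
Definition vertical_lift i (xi : tangent N) (X : 'rV[R]_n) : 'rV[R]_(n + n) :=
  derive1 (fun t : R => row_mx (coord i (base xi)) (comp xi i + t *: X)) 0.

(* The curve c is the parallel transport of xi along the geodesic of initial
   velocity X obtained by projecting c to N. *)
Definition horizontal_lift nabla i (xi : tangent N) (X : 'rV[R]_n)
    (w : 'rV[R]_(n + n)) : Prop :=
  exists2 e : R, 0 < e & exists c : R -> tangent N,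
    let z t := tcoord i (c t) in
    let x t := coord i (base (c t)) in
    let y t := comp (c t) i in
    [/\ forall t, ball 0 e t -> dom i (base (c t)),
        smooth_on (ball 0 e) z,
        forall t, ball 0 e t -> cov_along (nabla i) x (derive1 x) t = 0,
        forall t, ball 0 e t -> cov_along (nabla i) x y t = 0 &
        [/\ c 0 = xi, derive1 x 0 = X & derive1 z 0 = w]].

(* The map hl exists and is unique, by the theorem on ordinary differential
   equations. *)
Definition sasakian g nabla (gt : metric (tangent_bundle N)) : Prop :=
  forall (i : chart N) (xi : tangent N), dom i (base xi) ->
  let G := gt i (tcoord i xi) in
  let g0 := g i (coord i (base xi)) in
  exists2 hl : 'rV[R]_n -> 'rV[R]_(n + n),
    forall X, horizontal_lift nabla i xi X (hl X) &
    forall X Y,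
      [/\ pairing G (vertical_lift i xi X) (vertical_lift i xi Y) = pairing g0 X Y,
          pairing G (hl X) (hl Y) = pairing g0 X Y &
          pairing G (vertical_lift i xi X) (hl Y) = 0].

End Geometry.

(* Main.v *)
Require Import Defs.
From HB Require Import structures.
From mathcomp Require Import all_boot all_order all_algebra.
From mathcomp Require Import all_classical all_reals topology normedtype derive.
From mathcomp Require Import ring lra.

Set Implicit Arguments.
Unset Strict Implicit.
Unset Printing Implicit Defensive.

Import Order.TTheory GRing.Theory Num.Theory.
Import numFieldNormedType.Exports.

Local Open Scope classical_set_scope.
Local Open Scope ring_scope.

(** In the coordinates (x, y) that a chart of M induces on its tangent bundle,
    put theta_u(x, y) = u2 + Gam_x(u1, y) for a vector u = (u1, u2), where Gam
    is the Christoffel map of the connection. The vertical lifts are the vectors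
    with u1 = 0 and the horizontal ones those with theta_u = 0, hence the
    Sasakian metric is
      G(u, w) = g_x(u1, w1) + g_x(theta_u, theta_w)   (sasakian_form).

    The curvature of G at the arguments (u, v, v, u) is an expression in the
    first two derivatives of G and in the Christoffel vectors of u and v
    (riemE). Let R be the curvature tensor of the connection. Evaluating this
    expression at (x, y), on lifts of vectors u, v of the base, gives
      c - 3/4 |R(u, v)y|^2     if both lifts are horizontal (riem_hh),
      c + 1/4 |rho|^2          if one is horizontal, the other vertical, where
                               g(rho, w) = g(v, R(u, w)y) for all w (riem_hv),
      c                        if both are vertical (riem_vv),
    where c depends on u, v and x but not on y. These are O'Neill's formulas
    for the submersion of the bundle onto M; the tensor A of the submersion is
    linear in y, whereas the fibres contribute terms constant in y. The
    constants c need not be computed: along the ray (x, t y) the three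
    curvatures are affine functions of t ^ 2, and only the slopes matter.

    If the connection is not flat, R(u, v)y <> 0 for some x, u, v, y. Since R is
    bilinear in (u, v), the vectors u and v may be taken in a g-orthonormal frame
    e at x, which turns the denominators of the sectional curvatures into 1.
    The horizontal plane has curvature tending to minus infinity with t, and a
    mixed plane has curvature tending to plus infinity. In the scalar curvature
    the two effects compete. Let S be the sum of the |R(e_a, e_b)y|^2; Parseval's
    identity shows that the |rho|^2 also sum to S, each mixed plane counting
    twice, so that the coefficient of t ^ 2 is (- 3/4 + 1/4 + 1/4) S = - S / 4
    (scalar_total), which is negative. *)

(** * Bilinear forms and Christoffel maps at a point *)

Section Pairing.
Context {R : realType} {n : nat}.
Implicit Types (A B : 'M[R]_n) (u v w : 'rV[R]_n) (a : R).

Lemma pairingDl A u v w : pairing A (u + v) w = pairing A u w + pairing A v w.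
Proof. by rewrite /pairing !mulmxDl mxE. Qed.

Lemma pairingZl A a u w : pairing A (a *: u) w = a * pairing A u w.
Proof. by rewrite /pairing -!scalemxAl mxE. Qed.

Lemma pairingDr A u v w : pairing A u (v + w) = pairing A u v + pairing A u w.
Proof. by rewrite /pairing linearD /= mulmxDr mxE. Qed.

Lemma pairingZr A a u w : pairing A u (a *: w) = a * pairing A u w.
Proof. by rewrite /pairing linearZ /= -!scalemxAr mxE. Qed.

Lemma pairingNl A u w : pairing A (- u) w = - pairing A u w.
Proof. by rewrite -scaleN1r pairingZl mulN1r. Qed.

Lemma pairingNr A u w : pairing A u (- w) = - pairing A u w.
Proof. by rewrite -scaleN1r pairingZr mulN1r. Qed.

Lemma pairing0l A w : pairing A 0 w = 0.
Proof. by rewrite -(scale0r (0 : 'rV[R]_n)) pairingZl mul0r. Qed.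

Lemma pairing0r A w : pairing A w 0 = 0.
Proof. by rewrite -(scale0r (0 : 'rV[R]_n)) pairingZr mul0r. Qed.

Lemma pairingBl A u v w : pairing A (u - v) w = pairing A u w - pairing A v w.
Proof. by rewrite pairingDl pairingNl. Qed.

Lemma pairingBr A u v w : pairing A u (v - w) = pairing A u v - pairing A u w.
Proof. by rewrite pairingDr pairingNr. Qed.

Lemma pairingDm A B u v : pairing (A + B) u v = pairing A u v + pairing B u v.
Proof. by rewrite /pairing mulmxDr mulmxDl mxE. Qed.

Lemma pairingZm a A u v : pairing (a *: A) u v = a * pairing A u v.
Proof. by rewrite /pairing -scalemxAr -scalemxAl mxE. Qed.

Lemma pairing0m u v : pairing 0 u v = 0.
Proof. by rewrite /pairing mulmx0 mul0mx mxE. Qed.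

Lemma pairing_suml A I (r : seq I) (F : I -> 'rV[R]_n) w :
  pairing A (\sum_(i <- r) F i) w = \sum_(i <- r) pairing A (F i) w.
Proof.
elim: r => [|i r IH]; first by rewrite !big_nil pairing0l.
by rewrite !big_cons pairingDl IH.
Qed.

Lemma pairing_sumr A I (r : seq I) (F : I -> 'rV[R]_n) w :
  pairing A w (\sum_(i <- r) F i) = \sum_(i <- r) pairing A w (F i).
Proof.
elim: r => [|i r IH]; first by rewrite !big_nil pairing0r.
by rewrite !big_cons pairingDr IH.
Qed.

Lemma pairing_summ I (r : seq I) (F : I -> 'M[R]_n) u w :
  pairing (\sum_(i <- r) F i) u w = \sum_(i <- r) pairing (F i) u w.
Proof.
elim: r => [|i r IH]; first by rewrite !big_nil pairing0m.
by rewrite !big_cons pairingDm IH.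
Qed.

Lemma pairing_sym A u v : A^T = A -> pairing A u v = pairing A v u.
Proof.
move=> sA; rewrite /pairing -[in RHS]sA.
have <- : ((u *m A *m v^T)^T) 0 0 = (u *m A *m v^T) 0 0 by rewrite mxE.
by rewrite !trmx_mul trmxK mulmxA.
Qed.

Lemma pairing_delta A i j : pairing A (delta_mx 0 i) (delta_mx 0 j) = A i j.
Proof. by rewrite /pairing -rowE trmx_delta -colE !mxE. Qed.

Lemma pairing_mul A u w : A \in unitmx -> pairing A (u *m invmx A) w = (u *m w^T) 0 0.
Proof. by move=> uA; rewrite /pairing mulmxKV. Qed.

Lemma pairing_inj A u v : A \in unitmx ->
  (forall w, pairing A u w = pairing A v w) -> u = v.
Proof.
move=> uA uv; suff : u *m A = v *m A by move/(can_inj (mulmxK uA)).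
apply/rowP => j; have := uv (delta_mx 0 j).
by rewrite /pairing trmx_delta -!colE !mxE.
Qed.

(** Representing functionals by vectors yields the Christoffel vectors of a
    metric without any formula for its inverse. *)
Lemma pairing_riesz A (phi : 'rV[R]_n -> R) : A \in unitmx ->
  (forall a u v, phi (a *: u + v) = a * phi u + phi v) ->
  exists c, forall w, pairing A c w = phi w.
Proof.
move=> uA lphi; pose F : {scalar 'rV[R]_n} :=
  HB.pack phi (GRing.isLinear.Build _ _ _ _ (phi : _ -> R^o) lphi).
exists ((\row_k phi (delta_mx 0 k)) *m invmx A) => w.
rewrite -[phi w]/(F w) pairing_mul// mxE [in RHS](row_sum_delta w) linear_sum.
by apply: eq_bigr => k _; rewrite !mxE linearZ /= mulrC.
Qed.

Lemma posdef_unit A : (forall u, u != 0 -> 0 < pairing A u u) -> A \in unitmx.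
Proof.
move=> pA; rewrite -row_free_unit -kermx_eq0; apply/rowV0P => u /sub_kermxP uA.
apply/eqP/negPn/negP => /pA; by rewrite /pairing uA mul0mx mxE ltxx.
Qed.

End Pairing.

Section ConnectionVec.
Context {R : realType} {n : nat}.
Implicit Types (G : 'I_n -> 'rV[R]_n -> 'M[R]_n) (x u v w : 'rV[R]_n) (a : R).

Lemma connection_vecPl G x a u v w : connection_vec G x (a *: u + v) w =
  a *: connection_vec G x u w + connection_vec G x v w.
Proof. by apply/rowP => k; rewrite !mxE pairingDl pairingZl. Qed.

Lemma connection_vecPr G x a u v w : connection_vec G x w (a *: u + v) =
  a *: connection_vec G x w u + connection_vec G x w v.
Proof. by apply/rowP => k; rewrite !mxE pairingDr pairingZr. Qed.

Lemma connection_vec_comb (A B C : 'I_n -> 'rV[R]_n -> 'M[R]_n) x a u v :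
  (forall k, A k x = a *: B k x + C k x) ->
  connection_vec A x u v = a *: connection_vec B x u v + connection_vec C x u v.
Proof. by move=> E; apply/rowP => k; rewrite !mxE E pairingDm pairingZm. Qed.

Lemma connection_vec0l G x u : connection_vec G x 0 u = 0.
Proof. by apply/rowP => k; rewrite !mxE pairing0l. Qed.

Lemma connection_vec0r G x u : connection_vec G x u 0 = 0.
Proof. by apply/rowP => k; rewrite !mxE pairing0r. Qed.

End ConnectionVec.

(** * Differential calculus of matrix-valued maps *)

Section MatrixCalculus.
Context {R : realType} {V : normedModType R}.
Implicit Types (x v : V).

Lemma is_derive_mxP m n (F : V -> 'M[R]_(m, n)) x v dF :
  is_derive x v F dF <-> forall i j, is_derive x v (fun y => F y i j) (dF i j).
Proof.
split=> [[dx <-] i j|h].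
  by rewrite derive_mx // mxE; apply/derivableP; move/derivable_mxP: dx; exact.
have dx : derivable F x v by apply/derivable_mxP => i j; have [] := h i j.
split=> //; rewrite derive_mx //; apply/matrixP => i j; rewrite mxE.
by have [] := h i j.
Qed.

Lemma is_derive_mulmx m n p (F : V -> 'M[R]_(m, n)) (G : V -> 'M[R]_(n, p))
    x v dF dG : is_derive x v F dF -> is_derive x v G dG ->
  is_derive x v (fun y => F y *m G y) (dF *m G x + F x *m dG).
Proof.
move=> /is_derive_mxP hF /is_derive_mxP hG; apply/is_derive_mxP => i j.
have -> : (fun y => (F y *m G y) i j) =
    \sum_(k < n) ((fun y => F y i k) * (fun y => G y k j)).
  by apply/funext => y; rewrite mxE fct_sumE.
have h (k : 'I_n) : is_derive x v ((fun y => F y i k) * (fun y => G y k j))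
    (F x i k *: dG k j + G x k j *: dF i k) by exact: is_deriveM.
apply: (is_derive_eq (is_derive_sum h)).
rewrite !mxE -big_split /=; apply: eq_bigr => k _.
by rewrite addrC /GRing.scale /= [G x k j * _]mulrC.
Qed.

Lemma is_derive_trmx m n (F : V -> 'M[R]_(m, n)) x v dF :
  is_derive x v F dF -> is_derive x v (fun y => (F y)^T) dF^T.
Proof.
move=> /is_derive_mxP hF; apply/is_derive_mxP => i j; rewrite mxE.
by under eq_fun do rewrite mxE.
Qed.

Lemma is_derive_pairing n (A : V -> 'M[R]_n) (p q : V -> 'rV[R]_n) x v dA dp dq :
  is_derive x v A dA -> is_derive x v p dp -> is_derive x v q dq ->
  is_derive x v (fun y => pairing (A y) (p y) (q y))
    (pairing dA (p x) (q x) + pairing (A x) dp (q x) + pairing (A x) (p x) dq).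
Proof.
move=> hA hp hq.
have /is_derive_mxP/(_ 0 0) :=
  is_derive_mulmx (is_derive_mulmx hp hA) (is_derive_trmx hq).
move=> h; apply: is_derive_eq h _.
have E (a b : 'M[R]_1) : (a + b) 0 0 = a 0 0 + b 0 0 by rewrite mxE.
by rewrite !mulmxDl !E /pairing [X in X + _ = _]addrC.
Qed.

Lemma is_derive_pairing_cst n (A : V -> 'M[R]_n) (p q : 'rV[R]_n) x v dA :
  is_derive x v A dA -> is_derive x v (fun y => pairing (A y) p q) (pairing dA p q).
Proof.
move=> hA; have := is_derive_pairing hA (is_derive_cst p x v) (is_derive_cst q x v).
by rewrite pairing0r pairing0l !addr0.
Qed.

(** The difference quotient of f \o L at z along w is that of f at L z along
    L w, so derivability of f in this single direction suffices. *)
Lemma is_derive_comp_linear (V' W : normedModType R) (L : {linear V' -> V})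
    (f : V -> W) (z w : V') df :
  is_derive (L z) (L w) f df -> is_derive z w (f \o L) df.
Proof.
have E : (fun h : R => h^-1 *: ((f \o L \o shift z) (h *: w) - (f \o L) z)) =
         (fun h => h^-1 *: ((f \o shift (L z)) (h *: L w) - f (L z))).
  by apply/funext => h /=; rewrite [L (_ + _)]linearP.
move=> [df1 df2]; split; first by move: df1; rewrite /derivable E.
by move: df2; rewrite /derive E.
Qed.

Lemma differentiable_mxP m n (F : V -> 'M[R]_(m, n)) x :
  differentiable F x <-> forall i j, differentiable (fun y => F y i j) x.
Proof.
split=> [dF i j|h].
  apply: (@differentiable_comp _ _ _ _ F (fun M : 'M_(m, n) => M i j)) => //.
  exact: differentiable_coord.
have -> : F = \sum_(i < m) \sum_(j < n) (fun y => F y i j *: delta_mx i j).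
  apply/funext => y; rewrite fct_sumE [LHS]matrix_sum_delta.
  by apply: eq_bigr => i _; rewrite fct_sumE.
apply: differentiable_sum => i; apply: differentiable_sum => j.
exact: differentiableZl.
Qed.

Lemma differentiable_prod I (r : seq I) (F : I -> V -> R) x :
  (forall i, differentiable (F i) x) ->
  differentiable (fun y => \prod_(i <- r) F i y) x.
Proof.
move=> h; elim: r => [|i r IH].
  by under eq_fun do rewrite big_nil; exact: differentiable_cst.
by under eq_fun do rewrite big_cons; apply: differentiableM.
Qed.

Lemma differentiable_bigsum I (r : seq I) (F : I -> V -> R) x :
  (forall i, differentiable (F i) x) ->
  differentiable (fun y => \sum_(i <- r) F i y) x.
Proof.
move=> h; elim: r => [|i r IH].
  by under eq_fun do rewrite big_nil; exact: differentiable_cst.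
by under eq_fun do rewrite big_cons; apply: differentiableD.
Qed.

Lemma differentiable_det n (F : V -> 'M[R]_n) x :
  differentiable F x -> differentiable (fun y => \det (F y)) x.
Proof.
move=> /differentiable_mxP dF; rewrite /determinant.
apply: differentiable_bigsum => s; apply: differentiableM.
  exact: differentiable_cst.
by apply: differentiable_prod => i.
Qed.

(** By Cramer's formula the entries of the inverse are rational functions of
    those of the matrix. *)
Lemma differentiable_invmx n (F : V -> 'M[R]_n) x :
  (\forall y \near x, F y \in unitmx) ->
  differentiable F x -> differentiable (fun y => invmx (F y)) x.
Proof.
move=> uF dF.
apply: (@differentiable_near_eq _ _ _ (fun y => (\det (F y))^-1 *: \adj (F y))).
  by apply: filterS uF => y uy; rewrite /invmx uy.
apply/differentiable_mxP => i j; under eq_fun do rewrite !mxE.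
have d0 : \det (F x) != 0 by move/nbhs_singleton: uF; rewrite unitmxE unitfE.
apply: differentiableM.
  by apply: (@differentiableV _ _ (fun y => \det (F y))) => //; exact: differentiable_det.
rewrite /cofactor; apply: differentiableM; first exact: differentiable_cst.
apply: differentiable_det; apply/differentiable_mxP => a b.
by under eq_fun do rewrite !mxE; move/differentiable_mxP: dF; exact.
Qed.

End MatrixCalculus.

(** * The curvature of a connection *)

Section Curvature.
Context {R : realType} {n : nat}.
Local Notation V := 'rV[R]_n.
Implicit Types (G : 'I_n -> V -> 'M[R]_n) (x u v w : V).

Lemma is_derive_directional (E W : normedModType R) (f : E -> W) (x u : E) :
  differentiable f x -> is_derive x u f ('D_u f x).
Proof. by move=> df; apply/derivableP/diff_derivable. Qed.

(** Linearity of the differential. The values Du, Dv, Dw are named in the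
    hypotheses so that the conclusion uses the operations of matrices, and not
    the convertible ones of the normed module of matrices. *)
Lemma derive_linear_dir m p (f : V -> 'M[R]_(m, p)) x (a : R) (u v w : V)
    (Du Dv Dw : 'M[R]_(m, p)) : differentiable f x -> w = a *: u + v ->
  'D_u f x = Du -> 'D_v f x = Dv -> 'D_w f x = Dw -> Dw = a *: Du + Dv.
Proof. by move=> df -> <- <- <-; rewrite !deriveE//; exact: linearP. Qed.

Lemma derive_sum_delta (W : normedModType R) (f : V -> W) x u :
  differentiable f x -> 'D_u f x = \sum_a u 0 a *: 'D_(delta_mx 0 a) f x.
Proof.
move=> df; rewrite deriveE// [in LHS](row_sum_delta u) linear_sum.
by apply: eq_bigr => a _; rewrite linearZ /= -deriveE.
Qed.

Definition dconn G u : 'I_n -> V -> 'M[R]_n := fun k => 'D_u (G k).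

Lemma is_derive_connection_vec (E : normedModType R) (L : {linear E -> V}) G
    (p q : E -> V) (z w : E) dp dq :
  (forall k, derivable (G k) (L z) (L w)) ->
  is_derive z w p dp -> is_derive z w q dq ->
  is_derive z w (fun y => connection_vec G (L y) (p y) (q y))
   (connection_vec (dconn G (L w)) (L z) (p z) (q z)
    + connection_vec G (L z) dp (q z) + connection_vec G (L z) (p z) dq).
Proof.
move=> dG hp hq; apply/is_derive_mxP => i k; rewrite !mxE.
under eq_fun do rewrite mxE.
apply: (is_derive_pairing (A := G k \o L)) => //.
by apply: is_derive_comp_linear; apply/derivableP.
Qed.

(** Constant coordinate fields commute and have cov v w = Gam (v, w), so only the
    derivatives of the symbols and their products remain. *)
Lemma curvature_atE G x u v w : (forall k, differentiable (G k) x) ->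
  curvature_at G x u v w =
    connection_vec (dconn G u) x v w - connection_vec (dconn G v) x u w
    + connection_vec G x u (connection_vec G x v w)
    - connection_vec G x v (connection_vec G x u w).
Proof.
move=> dG; rewrite /curvature_at /curvature.
have covE a b : cov G (cst a) (cst b) = fun y => connection_vec G y a b.
  by apply/funext => y; rewrite /cov derive_cst add0r.
have lie0 : lie (cst u) (cst v) x = 0 by rewrite /lie !derive_cst subrr.
rewrite [cov G (lie _ _) _ _]/cov lie0 derive0 connection_vec0l addr0 subr0.
have D a b c : 'D_a (cov G (cst b) (cst c)) x = connection_vec (dconn G a) x b c.
  rewrite covE.
  have := @is_derive_connection_vec _ idfun G (cst b) (cst c) x a 0 0 _
    (is_derive_cst _ _ _) (is_derive_cst _ _ _).
  rewrite connection_vec0l connection_vec0r !addr0 => h.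
  by apply: derive_val; apply: h => k; exact: diff_derivable.
have covx a Y : cov G (cst a) Y x = 'D_a Y x + connection_vec G x a (Y x) by [].
by rewrite !(covx _ (cov _ _ _)) !D !covE opprD addrACA !addrA.
Qed.

End Curvature.

(** * The Levi-Civita connection *)

(** The Christoffel symbols of the first kind of a metric whose derivative in
    the direction u is D u. *)
Definition chr1 (R : realType) (n : nat) (D : 'rV[R]_n -> 'M[R]_n)
    (u v w : 'rV[R]_n) : R :=
  2^-1 * (pairing (D u) v w + pairing (D v) u w - pairing (D w) u v).

Definition riem (R : realType) (n : nat) (h : 'rV[R]_n -> 'M[R]_n)
    (x u v : 'rV[R]_n) : R :=
  pairing (h x) (curvature_at (levi_civita h) x u v v) u.

Section FirstKind.
Context {R : realType} {n : nat}.
Variable D : 'rV[R]_n -> 'M[R]_n.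
Hypothesis D_sum : forall u, D u = \sum_a u 0 a *: D (delta_mx 0 a).
Implicit Types u v w : 'rV[R]_n.

Lemma pairing_sum2 (A : 'M[R]_n) u v :
  pairing A u v = \sum_a \sum_b u 0 a * v 0 b * A a b.
Proof.
rewrite [in LHS](row_sum_delta u) pairing_suml; apply: eq_bigr => a _.
rewrite pairingZl [in LHS](row_sum_delta v) pairing_sumr mulr_sumr.
by apply: eq_bigr => b _; rewrite pairingZr pairing_delta mulrA.
Qed.

Lemma chr1_delta u v l : chr1 D u v (delta_mx 0 l) =
  2^-1 * \sum_a \sum_b u 0 a * v 0 b *
    (D (delta_mx 0 a) b l + D (delta_mx 0 b) a l - D (delta_mx 0 l) a b).
Proof.
rewrite /chr1; congr (_ * _).
have E A (y : 'rV[R]_n) : pairing A y (delta_mx 0 l) = \sum_b y 0 b * A b l.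
  rewrite [in LHS](row_sum_delta y) pairing_suml; apply: eq_bigr => b _.
  by rewrite pairingZl pairing_delta.
have -> : pairing (D u) v (delta_mx 0 l) =
    \sum_a \sum_b u 0 a * v 0 b * D (delta_mx 0 a) b l.
  rewrite (D_sum u) pairing_summ; apply: eq_bigr => a _.
  by rewrite pairingZm E mulr_sumr; apply: eq_bigr => b _; rewrite mulrA.
have -> : pairing (D v) u (delta_mx 0 l) =
    \sum_a \sum_b u 0 a * v 0 b * D (delta_mx 0 b) a l.
  rewrite (D_sum v) pairing_summ exchange_big.
  apply: eq_bigr => a _; rewrite pairingZm E mulr_sumr.
  by apply: eq_bigr => b _; rewrite mulrA [v 0 a * _]mulrC.
rewrite pairing_sum2 -big_split -sumrB; apply: eq_bigr => a _ /=.
rewrite -big_split -sumrB; apply: eq_bigr => b _ /=.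
by rewrite mulrBr mulrDr.
Qed.

Lemma chr1_sum u v w :
  chr1 D u v w = \sum_l w 0 l * chr1 D u v (delta_mx 0 l).
Proof.
have E A (y : 'rV[R]_n) :
    pairing A y w = \sum_l w 0 l * pairing A y (delta_mx 0 l).
  rewrite [in LHS](row_sum_delta w) pairing_sumr; apply: eq_bigr => l _.
  by rewrite pairingZr.
rewrite /chr1 (D_sum w) pairing_summ !E.
rewrite -big_split -sumrB mulr_sumr; apply: eq_bigr => l _ /=.
by rewrite pairingZm; ring.
Qed.

Lemma pairing4l (A : 'M[R]_n) (a b c d z : 'rV[R]_n) :
  pairing A (a - b + c - d) z =
  pairing A a z - pairing A b z + pairing A c z - pairing A d z.
Proof. by rewrite pairingBl pairingDl pairingBl. Qed.

Lemma sub4_eq (W : zmodType) (a a' b b' c c' d d' : W) :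
  a = a' -> b = b' -> c = c' -> d = d' -> a - b + c - d = a' - b' + c' - d'.
Proof. by move=> -> -> -> ->. Qed.

(** The terms containing the first derivatives of the metric: those with q
    combine into minus the Christoffel symbol of (u, u) against q, those with r
    into the symbol of (u, v) against r. *)
Lemma riem_algebra (u v q r : 'rV[R]_n) (Du Dv Dr Dq Duv Dvu Duu Dvv : 'M[R]_n) :
  pairing Duv v u = pairing Duv u v -> pairing Dvu v u = pairing Dvu u v ->
  pairing Du u q = pairing Du q u -> pairing Du v r = pairing Du r v ->
  pairing Dv u r = pairing Dv r u -> pairing Dr v u = pairing Dr u v ->
  2^-1 * (pairing Duv v u + pairing Duv v u - pairing Duu v v) - pairing Du q u
  - (2^-1 * (pairing Dvu v u + pairing Dvv u u - pairing Dvu u v) - pairing Dv r u)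
  + 2^-1 * (pairing Du q u + pairing Dq u u - pairing Du u q)
  - 2^-1 * (pairing Dv r u + pairing Dr v u - pairing Du v r) =
  pairing Duv u v - 2^-1 * pairing Duu v v - 2^-1 * pairing Dvv u u
  + 2^-1 * (pairing Du v r + pairing Dv u r - pairing Dr u v)
  - 2^-1 * (pairing Du u q + pairing Du u q - pairing Dq u u).
Proof. by move=> -> -> -> -> -> ->; field. Qed.

End FirstKind.

Section LeviCivita.
Context {R : realType} {n : nat}.
Local Notation V := 'rV[R]_n.
Variables (h : V -> 'M[R]_n) (U : set V).
Hypotheses (oU : open U) (hU : diff_upto 1 U h).
Hypotheses (symh : forall x, U x -> (h x)^T = h x).
Hypotheses (unith : forall x, U x -> h x \in unitmx).
Implicit Types (x u v w : V).

Let nearU x : U x -> \near x, U x.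
Proof. by move=> Ux; exact: open_nbhs_nbhs. Qed.

Let diffh x : U x -> differentiable h x. Proof. exact: hU.1. Qed.

Let diffDh x u : U x -> differentiable ('D_u h) x. Proof. exact: (hU.2 u).1. Qed.

Let derive_entry x u i j : U x -> 'D_u (fun y => h y i j) x = 'D_u h x i j.
Proof.
move=> Ux; rewrite derive_mx ?mxE//; exact: diff_derivable (diffh Ux).
Qed.

Let derive_sum x u : U x ->
  'D_u h x = \sum_a u 0 a *: 'D_(delta_mx 0 a) h x.
Proof. by move=> Ux; exact: derive_sum_delta (diffh Ux). Qed.

Lemma connection_vec_levi_civita x u v w : U x ->
  pairing (h x) (connection_vec (levi_civita h) x u v) w =
  chr1 (fun u => 'D_u h x) u v w.
Proof.
move=> Ux; have Dx := fun u => derive_sum u Ux.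
have lcE k a b : levi_civita h k x a b = 2^-1 * \sum_l invmx (h x) k l *
    ('D_(delta_mx 0 a) h x b l + 'D_(delta_mx 0 b) h x a l
     - 'D_(delta_mx 0 l) h x a b).
  rewrite mxE; congr (_ * _); apply: eq_bigr => l _.
  by rewrite !derive_entry.
move: lcE Dx; set D := fun u => 'D_u h x => lcE Dx.
pose s := \row_l chr1 D u v (delta_mx 0 l).
have CE : (connection_vec (levi_civita h) x u v)^T = invmx (h x) *m s^T.
  apply/matrixP => k j; rewrite !mxE pairing_sum2.
  under [RHS]eq_bigr do rewrite !mxE chr1_delta// mulr_sumr mulr_sumr.
  rewrite [RHS]exchange_big /=; apply: eq_bigr => a _.
  under [RHS]eq_bigr do rewrite mulr_sumr mulr_sumr.
  rewrite [RHS]exchange_big /=; apply: eq_bigr => b _.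
  rewrite lcE !mulr_sumr; apply: eq_bigr => l _.
  by rewrite -/(D _) -/(D _) -/(D _); ring.
rewrite pairing_sym ?symh// /pairing CE mulmxA mulmxK ?unith//.
by rewrite (chr1_sum Dx) mxE; apply: eq_bigr => l _; rewrite !mxE.
Qed.

Lemma symD x u : U x -> ('D_u h x)^T = 'D_u h x.
Proof.
move=> Ux; apply/matrixP => i j; rewrite mxE -!derive_entry//.
apply: near_eq_derive; apply: filterS (nearU Ux) => y Uy.
by rewrite -[in RHS]symh// mxE.
Qed.

Lemma symDD x u v : U x -> ('D_u ('D_v h) x)^T = 'D_u ('D_v h) x.
Proof.
move=> Ux.
have E i j : 'D_u ('D_v h) x i j = 'D_u (fun y => 'D_v h y i j) x.
  by rewrite derive_mx ?mxE//; exact: diff_derivable (diffDh _ Ux).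
apply/matrixP => i j; rewrite mxE !E.
apply: near_eq_derive; apply: filterS (nearU Ux) => y Uy.
by rewrite -[in RHS]symD// mxE.
Qed.

Lemma differentiable_levi_civita x k : U x -> differentiable (levi_civita h k) x.
Proof.
move=> Ux; apply/differentiable_mxP => a b; rewrite /levi_civita.
under eq_fun do rewrite mxE.
apply: differentiableM; first exact: differentiable_cst.
apply: differentiable_bigsum => l; apply: differentiableM.
  apply/(differentiable_mxP (fun y => invmx (h y)) x).1.
  apply: differentiable_invmx (diffh Ux).
  by apply: filterS (nearU Ux).
have dE c i j : differentiable ('D_(delta_mx 0 c) (fun y => h y i j)) x.
  apply: (@differentiable_near_eq _ _ _ (fun y => 'D_(delta_mx 0 c) h y i j)).
    by apply: filterS (nearU Ux) => y Uy; rewrite derive_entry.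
  by move/differentiable_mxP: (diffDh (delta_mx 0 c) Ux); exact.
by apply: differentiableB => //; apply: differentiableD.
Qed.

(** Obtained by differentiating h (Gam (v, w), z) = chr1 v w z along u, which
    never differentiates the inverse of the metric. *)
Lemma levi_civita_derive x u v w z : U x ->
  pairing (h x) (connection_vec (dconn (levi_civita h) u) x v w) z =
  2^-1 * (pairing ('D_u ('D_v h) x) w z + pairing ('D_u ('D_w h) x) v z
          - pairing ('D_u ('D_z h) x) v w)
  - pairing ('D_u h x) (connection_vec (levi_civita h) x v w) z.
Proof.
move=> Ux.
have dC : is_derive x u (fun y => connection_vec (levi_civita h) y v w)
    (connection_vec (dconn (levi_civita h) u) x v w).
  have := @is_derive_connection_vec _ _ _ idfun (levi_civita h) (cst v) (cst w)
    x u 0 0 _ (is_derive_cst _ _ _) (is_derive_cst _ _ _).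
  rewrite connection_vec0l connection_vec0r !addr0 => H.
  by apply: H => k; exact/diff_derivable/differentiable_levi_civita.
have := is_derive_pairing (is_derive_directional u (diffh Ux)) dC
  (is_derive_cst z x u).
rewrite pairing0r addr0 => -[_ D1].
have dd a b c : is_derive x u (fun y => pairing ('D_a h y) b c)
    (pairing ('D_u ('D_a h) x) b c).
  exact: is_derive_pairing_cst (is_derive_directional u (diffDh a Ux)).
have D2 : is_derive x u (fun y => chr1 (fun u => 'D_u h y) v w z)
  (2^-1 * (pairing ('D_u ('D_v h) x) w z + pairing ('D_u ('D_w h) x) v z
          - pairing ('D_u ('D_z h) x) v w)).
  by apply: is_deriveZ; apply: is_deriveB; apply: is_deriveD.
suff E : 'D_u (fun y => pairing (h y) (connection_vec (levi_civita h) y v w) z)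
    x = 'D_u (fun y => chr1 (fun u => 'D_u h y) v w z) x.
  by case: D2 => _ <-; rewrite -E D1 addrC addKr.
apply: near_eq_derive; apply: filterS (nearU Ux) => y Uy.
exact: connection_vec_levi_civita.
Qed.

(** The classical coordinate formula for the four-index curvature, with p, q and
    r the Christoffel vectors of (u, u), (v, v) and (u, v), characterized by
    duality. The order of the mixed second derivative is kept, so that no
    symmetry of second derivatives enters. *)
Lemma riemE x u v p q r : U x ->
  (forall w, pairing (h x) p w = chr1 (fun u => 'D_u h x) u u w) ->
  (forall w, pairing (h x) q w = chr1 (fun u => 'D_u h x) v v w) ->
  (forall w, pairing (h x) r w = chr1 (fun u => 'D_u h x) u v w) ->
  riem h x u v =
    pairing ('D_u ('D_v h) x) u v - 2^-1 * pairing ('D_u ('D_u h) x) v v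
    - 2^-1 * pairing ('D_v ('D_v h) x) u u
    + pairing (h x) r r - pairing (h x) p q.
Proof.
move=> Ux hp hq hr; rewrite /riem curvature_atE; last first.
  by move=> k; exact: differentiable_levi_civita.
have Cr : connection_vec (levi_civita h) x u v = r.
  by apply: (pairing_inj (unith Ux)) => w; rewrite hr connection_vec_levi_civita.
have Cq : connection_vec (levi_civita h) x v v = q.
  by apply: (pairing_inj (unith Ux)) => w; rewrite hq connection_vec_levi_civita.
have E1 := levi_civita_derive u v v u Ux.
have E2 := levi_civita_derive v u v u Ux.
have E3 := connection_vec_levi_civita u q u Ux.
have E4 := connection_vec_levi_civita v r u Ux.
rewrite Cq in E1 *; rewrite Cr in E2 *.
apply: etrans (pairing4l _ _ _ _ _ _) _.
apply: etrans (sub4_eq E1 E2 E3 E4) _.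
rewrite (hp q) (hr r).
rewrite /chr1; apply: riem_algebra.
- exact: pairing_sym (symDD u v Ux).
- exact: pairing_sym (symDD v u Ux).
- exact: pairing_sym (symD u Ux).
- exact: pairing_sym (symD u Ux).
- exact: pairing_sym (symD v Ux).
- exact: pairing_sym (symD r Ux).
Qed.

End LeviCivita.

(** * Traces in an orthonormal frame *)

Section Trace.
Context {R : realType} {n : nat}.
Local Notation V := 'rV[R]_n.

Lemma linear_comb_sum (W : lmodType R) (f : V -> W) m (a : 'I_m -> R) (e : 'I_m -> V) :
  linear f -> f (\sum_c a c *: e c) = \sum_c a c *: f (e c).
Proof.
move=> lf; pose F : {linear V -> W} := HB.pack f (GRing.isLinear.Build _ _ _ _ f lf).
rewrite -[f]/(F : V -> W) linear_sum.
by apply: eq_bigr => c _; rewrite linearZ.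
Qed.

Lemma linear_sum_delta (W : lmodType R) (f : V -> W) u :
  linear f -> f u = \sum_c u 0 c *: f (delta_mx 0 c).
Proof. by move=> lf; rewrite {1}(row_sum_delta u) linear_comb_sum. Qed.

Variables (G : 'I_n -> V -> 'M[R]_n) (x : V).
Hypothesis dG : forall k, differentiable (G k) x.

Let dconn_linear u u' (a : R) v w :
  connection_vec (dconn G (a *: u + u')) x v w =
  a *: connection_vec (dconn G u) x v w + connection_vec (dconn G u') x v w.
Proof.
apply: connection_vec_comb => k.
exact: (derive_linear_dir (dG k) erefl erefl erefl erefl).
Qed.

Let sub4_linear (a : R) (p q r s p' q' r' s' : V) :
  (a *: p + p') - (a *: q + q') + (a *: r + r') - (a *: s + s') =
  a *: (p - q + r - s) + (p' - q' + r' - s').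
Proof. by apply/rowP => k; rewrite !mxE; ring. Qed.

Local Notation C := (connection_vec G x).
Local Notation dC u := (connection_vec (dconn G u) x).

Lemma curvature_at_linear1 v w : linear (fun u => curvature_at G x u v w).
Proof.
move=> a u u'; do 3 rewrite curvature_atE//.
have E : C v (C (a *: u + u') w) = a *: C v (C u w) + C v (C u' w).
  by rewrite (connection_vecPl G x a u u' w) connection_vecPr.
apply: etrans (sub4_eq (dconn_linear u u' a v w)
  (connection_vecPl (dconn G v) x a u u' w)
  (connection_vecPl G x a u u' (C v w)) E) _.
exact: sub4_linear.
Qed.

Lemma curvature_at_linear2 u w : linear (fun v => curvature_at G x u v w).
Proof.
move=> a v v'; do 3 rewrite curvature_atE//.
have E : C u (C (a *: v + v') w) = a *: C u (C v w) + C u (C v' w).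
  by rewrite (connection_vecPl G x a v v' w) connection_vecPr.
apply: etrans (sub4_eq (connection_vecPl (dconn G u) x a v v' w)
  (dconn_linear v v' a u w) E
  (connection_vecPl G x a v v' (C u w))) _.
exact: sub4_linear.
Qed.

Lemma curvature_at_linear3 u v : linear (fun w => curvature_at G x u v w).
Proof.
move=> a w w'; do 3 rewrite curvature_atE//.
have E p q : C p (C q (a *: w + w')) = a *: C p (C q w) + C p (C q w').
  by rewrite (connection_vecPr G x a w w' q) connection_vecPr.
apply: etrans (sub4_eq (connection_vecPr (dconn G u) x a w w' v)
  (connection_vecPr (dconn G v) x a w w' u) (E u v) (E v u)) _.
exact: sub4_linear.
Qed.

Lemma curvature_at_scale3 (t : R) u v w :
  curvature_at G x u v (t *: w) = t *: curvature_at G x u v w.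
Proof.
have E0 : curvature_at G x u v 0 = 0.
  by have := curvature_at_linear3 u v (-1) 0 0; rewrite scaler0 addr0 scaleN1r addNr.
by have := curvature_at_linear3 u v t w 0; rewrite E0 !addr0.
Qed.

Lemma curvature_at_self u w : curvature_at G x u u w = 0.
Proof. by rewrite curvature_atE// subrr add0r subrr. Qed.

End Trace.

Section ScalarCurvature.
Context {R : realType} {n : nat}.
Local Notation V := 'rV[R]_n.

Lemma frame_invmx (A F : 'M[R]_n) : F *m A *m F^T = 1%:M -> A *m (F^T *m F) = 1%:M.
Proof. by move=> FAF; rewrite mulmxA; apply: mulmx1C; rewrite mulmxA. Qed.

(** F A F^T = 1 makes A F^T the inverse of F, so both sides are the trace of
    one endomorphism in two bases. *)
Lemma trace_frame (A F : 'M[R]_n) (T : V -> V) : linear T ->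
  F *m A *m F^T = 1%:M ->
  \sum_l pairing A (T (row l F)) (row l F) = \sum_c T (delta_mx 0 c) 0 c.
Proof.
move=> lT FAF; pose M := \matrix_c T (delta_mx 0 c).
have TE u : T u = u *m M.
  rewrite (linear_sum_delta u lT) mulmx_sum_row; apply: eq_bigr => c _.
  by rewrite rowK.
transitivity (\tr (F *m M *m A *m F^T)).
  apply: eq_bigr => l _; rewrite TE /pairing -!row_mul !mxE.
  by apply: eq_bigr => j _; rewrite !mxE.
rewrite mxtrace_mulC !mulmxA -mulmxA mxtrace_mulC -!mulmxA.
rewrite frame_invmx// mulmx1 /mxtrace.
by apply: eq_bigr => c _; rewrite mxE.
Qed.

(** F A F^T = 1 means that F^T F is the inverse of A. *)
Lemma bilinear_frame (A F : 'M[R]_n) (B : V -> V -> R) :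
  (forall v, linear (B v : V -> R^o)) -> (forall w, linear (B^~ w : V -> R^o)) ->
  F *m A *m F^T = 1%:M ->
  \sum_k B (row k F) (row k F) =
  \sum_a \sum_b invmx A a b * B (delta_mx 0 a) (delta_mx 0 b).
Proof.
move=> l2 l1 FAF.
have iA : invmx A = F^T *m F.
  have AF := frame_invmx FAF; have [uA _] := mulmx1_unit AF.
  by rewrite -[LHS]mulmx1 -AF mulKmx.
transitivity (\sum_k \sum_a \sum_b F k a * F k b * B (delta_mx 0 a) (delta_mx 0 b)).
  apply: eq_bigr => k _.
  rewrite (linear_sum_delta (row k F) (l1 (row k F))); apply: eq_bigr => a _.
  rewrite (linear_sum_delta (row k F) (l2 (delta_mx 0 a))) mxE scaler_sumr.
  by apply: eq_bigr => b _; rewrite mxE /GRing.scale /= mulrA.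
rewrite exchange_big /=; apply: eq_bigr => a _.
rewrite exchange_big /=; apply: eq_bigr => b _.
rewrite -mulr_suml iA !mxE; congr (_ * _).
by apply: eq_bigr => k _; rewrite mxE.
Qed.

Let row_comb (p q r : V) (a : R) c :
  p = a *: q + r -> p 0 c = a * q 0 c + r 0 c.
Proof. by move=> ->; rewrite !mxE. Qed.

Lemma scalar_frame (h : V -> 'M[R]_n) (x : V) (F : 'M[R]_n) :
  (forall k, differentiable (levi_civita h k) x) ->
  F *m h x *m F^T = 1%:M ->
  Defs.scalar h x = \sum_k \sum_l riem h x (row l F) (row k F).
Proof.
move=> dG FhF; rewrite /Defs.scalar -(bilinear_frame (A := h x) (F := F) (B := ricci h x))//; last first.
- move=> w a v v'; rewrite /ricci scaler_sumr -big_split; apply: eq_bigr => c _ /=.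
  exact: (row_comb c (curvature_at_linear2 dG _ _ a v v')).
- move=> v a w w'; rewrite /ricci scaler_sumr -big_split; apply: eq_bigr => c _ /=.
  exact: (row_comb c (curvature_at_linear3 dG _ _ a w w')).
apply: eq_bigr => k _; rewrite /riem.
rewrite -[LHS](trace_frame (A := h x) (F := F)
  (curvature_at_linear1 dG (row k F) (row k F)))//.
Qed.

End ScalarCurvature.

Lemma frame_pairing (R : realType) m n (A : 'M[R]_n) (F : 'M[R]_(m, n)) i j :
  (F *m A *m F^T) i j = pairing A (row i F) (row j F).
Proof.
by rewrite /pairing -row_mul !mxE; apply: eq_bigr => k _; rewrite !mxE.
Qed.

Lemma parseval (R : realType) n (A P : 'M[R]_n) u : P *m A *m P^T = 1%:M ->
  pairing A u u = \sum_k pairing A u (row k P) ^+ 2.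
Proof.
move=> PAP; have AP : A *m P^T *m P = 1%:M by rewrite -mulmxA frame_invmx.
have E k : (u *m A *m P^T) 0 k = pairing A u (row k P).
  by rewrite /pairing !mxE; apply: eq_bigr => j _; rewrite !mxE.
transitivity ((u *m A *m P^T *m (u *m A *m P^T)^T) 0 0).
  rewrite !trmx_mul trmxK !mulmxA -[u *m A *m P^T *m P]mulmxA -[u *m A *m _]mulmxA.
  rewrite [A *m _]mulmxA AP mulmx1.
  rewrite -[pairing A u u]/((u *m A *m u^T) 0 0).
  by rewrite -[in RHS]mulmxA -trmx_mul -[in LHS](trmxK (u *m A)) -trmx_mul mxE.
by rewrite mxE; apply: eq_bigr => k _; rewrite [X in _ * X]mxE E expr2.
Qed.

(** One step of Gram-Schmidt: clearing the first row and column leaves the Schur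
    complement of the corner a, which is again positive definite. *)
Lemma orthonormal_frame (R : realType) n (A : 'M[R]_n) : A^T = A ->
  (forall u, u != 0 -> 0 < pairing A u u) -> exists P : 'M[R]_n, P *m A *m P^T = 1%:M.
Proof.
elim: n A => [|n IH] A sA pA; first by exists 1%:M; apply/matrixP => -[].
rewrite -[n.+1]/(1 + n)%N in A sA pA *.
pose b := ursubmx A; pose C := drsubmx A; pose a := A 0 0.
have AE : A = block_mx a%:M b b^T C.
  rewrite -[LHS]submxK; congr block_mx.
    by rewrite [LHS]mx11_scalar; congr (_%:M); rewrite !mxE; congr (A _ _); exact: val_inj.
  by rewrite -[in LHS]sA -trmx_ursub.
have a0 : 0 < a.
  rewrite /a -pairing_delta; apply: pA; apply/eqP => /rowP/(_ 0)/eqP.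
  by rewrite !mxE !eqxx oner_eq0.
have an0 : a != 0 by rewrite gt_eqF.
have sC : C^T = C by rewrite trmx_drsub sA.
pose T : 'M[R]_(1 + n) := block_mx 1%:M 0 (- a^-1 *: b^T) 1%:M.
pose S := C - a^-1 *: (b^T *m b).
have TAT : T *m A *m T^T = block_mx a%:M 0 0 S.
  rewrite AE /T tr_block_mx !mulmx_block !trmx1 !trmx0 !mul1mx !mul0mx !mulmx1.
  rewrite ?mulmx0 ?addr0 ?add0r linearZ /= trmxK -!scalemxAl -!scalemxAr.
  rewrite mul_mx_scalar mul_scalar_mx !scalerA mulNr mulVf//.
  rewrite !scaleN1r !addNr mul0mx scaler0 add0r.
  by rewrite /S addrC scaleNr.
have pS u : u != 0 -> 0 < pairing S u u.
  move=> u0; have -> : pairing S u u =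
      pairing A (row_mx 0 u *m T) (row_mx 0 u *m T).
    rewrite /pairing trmx_mul !mulmxA -[row_mx 0 u *m T *m A]mulmxA.
    rewrite -[X in _ = (X *m _) 0 0]mulmxA TAT mul_row_block tr_row_mx mul_row_col.
    by rewrite !mul0mx !mulmx0 trmx0 mulmx0 !add0r.
  apply: pA; apply: contraNneq u0; rewrite mul_row_block !mul0mx !add0r mulmx1 => u0.
  by rewrite -[u](row_mxKr (u *m (- a^-1 *: b^T))) u0 linear0.
have sS : S^T = S.
  by rewrite /S linearB /= linearZ /= trmx_mul trmxK sC.
have [Q QSQ] := IH S sS pS.
exists (block_mx (Num.sqrt a)^-1%:M 0 0 Q *m T).
rewrite trmx_mul !mulmxA -[_ *m T *m A]mulmxA.
rewrite -[_ *m (T *m A) *m _]mulmxA TAT mulmx_block tr_block_mx mulmx_block.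
rewrite !mul0mx !mulmx0 !addr0 !add0r !trmx0 !mulmx0 !mul0mx QSQ.
rewrite tr_scalar_mx -!scalar_mxM scalar_mx_block.
congr block_mx; rewrite ?addr0 ?add0r//; congr (_%:M).
rewrite -[in X in _ * X * _](sqr_sqrtr (ltW a0)) expr2 mulrA mulVf ?mul1r ?mulfV//.
all: by rewrite gt_eqF ?sqrtr_gt0.
Qed.

(** * The second-order jet of a Sasakian metric *)

(** The derivatives of a Sasakian metric at a point over x depend on the metric
    and the connection of the base only through their 2-jets at x, and on the
    point through its fibre coordinate y. Abstracting the jet into gm, dg, ddg
    (the metric and its derivatives along one and two vectors) and C, C1, C2 (the
    Christoffel map and its derivatives) makes the curvature computation purely
    algebraic. A tangent vector of the total space is a pair (base component,
    fibre component). *)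
Section SasakiJet.
Context {R : realType} {n : nat}.
Local Notation V := 'rV[R]_n.
Variables (gm : 'M[R]_n) (dg : V -> 'M[R]_n) (ddg : V -> V -> 'M[R]_n).
Variables (C : V -> V -> V) (C1 : V -> V -> V -> V) (C2 : V -> V -> V -> V -> V).
Hypotheses (gm_sym : gm^T = gm) (gm_unit : gm \in unitmx).
Hypothesis dg_sym : forall u, (dg u)^T = dg u.
Hypothesis dgP : forall a u v, dg (a *: u + v) = a *: dg u + dg v.
Hypothesis ddg0l : forall u, ddg 0 u = 0.
Hypothesis ddg0r : forall u, ddg u 0 = 0.
Hypothesis CPl : forall a u v w, C (a *: u + v) w = a *: C u w + C v w.
Hypothesis CPr : forall a u v w, C w (a *: u + v) = a *: C w u + C w v.
Hypothesis C1P1 : forall a u v w y,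
  C1 (a *: u + v) w y = a *: C1 u w y + C1 v w y.
Hypothesis C1P2 : forall a u v w y,
  C1 w (a *: u + v) y = a *: C1 w u y + C1 w v y.
Hypothesis C20l : forall u v y, C2 0 u v y = 0.
Hypothesis C20r : forall u v y, C2 u 0 v y = 0.
Hypothesis C20 : forall u v y, C2 u v 0 y = 0.

(** The map theta of the vertical projection, and its derivatives along w, then
    along w and w'. *)
Definition jet_vert (y : V) (u : V * V) : V := u.2 + C u.1 y.

Definition jet_vert1 (y : V) (u w : V * V) : V := C1 w.1 u.1 y + C u.1 w.2.

Definition jet_vert2 (y : V) (u w w' : V * V) : V :=
  C2 w.1 w'.1 u.1 y + C1 w.1 u.1 w'.2 + C1 w'.1 u.1 w.2.

Local Notation th := jet_vert.
Local Notation th1 := jet_vert1.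
Local Notation th2 := jet_vert2.
Local Notation gp := (pairing gm).

(** The metric on constant fields a, b, and its derivatives by the Leibniz rule. *)
Definition jet_form y (a b : V * V) : R := gp a.1 b.1 + gp (th y a) (th y b).

Definition jet_form1 y (a b w : V * V) : R :=
  pairing (dg w.1) a.1 b.1 + (pairing (dg w.1) (th y a) (th y b)
  + gp (th1 y a w) (th y b) + gp (th y a) (th1 y b w)).

Definition jet_form2 y (a b w w' : V * V) : R :=
  pairing (ddg w.1 w'.1) a.1 b.1 +
  ((pairing (ddg w.1 w'.1) (th y a) (th y b)
    + pairing (dg w.1) (th1 y a w') (th y b)
    + pairing (dg w.1) (th y a) (th1 y b w'))
   + (pairing (dg w'.1) (th1 y a w) (th y b) + gp (th2 y a w w') (th y b)
      + gp (th1 y a w) (th1 y b w'))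
   + (pairing (dg w'.1) (th y a) (th1 y b w) + gp (th1 y a w') (th1 y b w)
      + gp (th y a) (th2 y b w w'))).

Definition jet_chr1 y (u v w : V * V) : R :=
  2^-1 * (jet_form1 y v w u + jet_form1 y u w v - jet_form1 y u v w).

(** The right-hand side of riemE, as a relation because the Christoffel vectors
    p, q, r are only characterized by duality. *)
Definition jet_riem y (u v : V * V) (K : R) : Prop := exists p q r : V * V,
  [/\ forall w, jet_form y p w = jet_chr1 y u u w,
      forall w, jet_form y q w = jet_chr1 y v v w,
      forall w, jet_form y r w = jet_chr1 y u v w &
      K = jet_form2 y u v v u - 2^-1 * jet_form2 y v v u u
          - 2^-1 * jet_form2 y u u v v + jet_form y r r - jet_form y p q].

Definition jet_curv u v y : V := C1 u v y - C1 v u y + C u (C v y) - C v (C u y).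

Definition hlift y (u : V) : V * V := (u, - C u y).
Definition vlift (u : V) : V * V := (0, u).

Let C0l w : C 0 w = 0.
Proof. by have := CPl (-1) 0 0 w; rewrite scaler0 addr0 scaleN1r addNr. Qed.
Let C0r w : C w 0 = 0.
Proof. by have := CPr (-1) 0 0 w; rewrite scaler0 addr0 scaleN1r addNr. Qed.
Let C10l w y : C1 0 w y = 0.
Proof. by have := C1P1 (-1) 0 0 w y; rewrite scaler0 addr0 scaleN1r addNr. Qed.
Let C10r w y : C1 w 0 y = 0.
Proof. by have := C1P2 (-1) 0 0 w y; rewrite scaler0 addr0 scaleN1r addNr. Qed.
Let dg0 : dg 0 = 0.
Proof. by have := dgP (-1) 0 0; rewrite scaler0 addr0 scaleN1r addNr. Qed.
Let CNr u w : C w (- u) = - C w u.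
Proof. by have := CPr (-1) u 0 w; rewrite addr0 C0r addr0 !scaleN1r. Qed.
Let CDr u v w : C w (u + v) = C w u + C w v.
Proof. by have := CPr 1 u v w; rewrite !scale1r. Qed.

Let th_hlift y u : th y (hlift y u) = 0.
Proof. by rewrite /th /= addNr. Qed.
Let th_vlift y u : th y (vlift u) = u.
Proof. by rewrite /th /= C0l addr0. Qed.
Let th1_vlift y u w : th1 y (vlift u) w = 0.
Proof. by rewrite /th1 /= C10r C0l addr0. Qed.
Let th2_vlift y u w w' : th2 y (vlift u) w w' = 0.
Proof. by rewrite /th2 /= C20 !C10r !addr0. Qed.
Let th1_at_vlift y u w : th1 y u (vlift w) = C u.1 w.
Proof. by rewrite /th1 /= C10l add0r. Qed.

Let vecth y c d : {p : V * V | p.1 = c & th y p = d}.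
Proof. by exists (c, d - C c y) => //; rewrite /th /= subrK. Qed.

Let chr1_linear u v a w w' :
  chr1 dg u v (a *: w + w') = a * chr1 dg u v w + chr1 dg u v w'.
Proof.
rewrite /chr1 dgP !pairingDr !pairingZr pairingDm pairingZm; ring.
Qed.

Let zeroE := (@pairing0l R n, @pairing0r R n, @pairing0m R n, addr0, add0r).

(** Since theta vanishes on horizontal vectors, only products of its first
    derivatives enter, and those of D_u theta_u with D_v theta_v cancel. The
    derivatives a = D_u theta_v and b = D_v theta_u contribute
    a.b - a.a - b.b + |a + b|^2 / 4 = - 3/4 |a - b|^2, and a - b is the curvature of
    the connection applied to y. *)
Lemma jet_riem_hh u v : exists c, forall y,
  jet_riem y (hlift y u) (hlift y v)
    (c - 3 / 4 * gp (jet_curv u v y) (jet_curv u v y)).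
Proof.
have [cp hp] := pairing_riesz gm_unit (chr1_linear u u).
have [cq hq] := pairing_riesz gm_unit (chr1_linear v v).
have [cr hr] := pairing_riesz gm_unit (chr1_linear u v).
(* the curvature of the base along u and v *)
exists (pairing (ddg v u) u v - 2^-1 * pairing (ddg u u) v v
        - 2^-1 * pairing (ddg v v) u u + gp cr cr - gp cp cq) => y.
set uu := hlift y u; set vv := hlift y v.
have [p p1 pth] := vecth y cp (th1 y uu uu).
have [q q1 qth] := vecth y cq (th1 y vv vv).
have [r r1 rth] := vecth y cr (2^-1 *: (th1 y uu vv + th1 y vv uu)).
have chrE a b w : jet_chr1 y (hlift y a) (hlift y b) w = chr1 dg a b w.1 +
    gp (2^-1 *: (th1 y (hlift y a) (hlift y b) + th1 y (hlift y b) (hlift y a)))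
      (th y w).
  rewrite /jet_chr1 /jet_form1 !th_hlift !zeroE /= /chr1 pairingZl pairingDl; ring.
have half a : 2^-1 *: (a + a) = a :> V
  by apply/rowP => i; rewrite !mxE; field.
exists p, q, r; split.
- by move=> w; rewrite chrE half /jet_form p1 hp pth.
- by move=> w; rewrite chrE half /jet_form q1 hq qth.
- by move=> w; rewrite chrE /jet_form r1 hr rth.
have -> : jet_curv u v y = th1 y vv uu - th1 y uu vv.
  rewrite /jet_curv /th1 /= !CNr; apply/rowP => i; rewrite !mxE; ring.
rewrite /jet_form2 /jet_form p1 q1 r1 pth qth rth !th_hlift !zeroE /=.
move: (th1 y uu vv) (th1 y vv uu) (th1 y uu uu) (th1 y vv vv) => a b d e.
rewrite !(pairingZl, pairingZr, pairingDl, pairingDr, pairingNl, pairingNr).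
by rewrite (pairing_sym b a gm_sym); field.
Qed.

(** Along a vertical vector neither g nor Gam varies, so the second derivatives
    are constant in y. The Christoffel vector of (u, v) has base component
    rho / 2, the only part that depends on y, and it enters through its square;
    the one of (v, v) is horizontal, hence its product with that of (u, u) is
    also constant. *)
Lemma jet_riem_hv u v : exists c, forall y rho,
  (forall w, gp rho w = gp v (jet_curv u w y)) ->
  jet_riem y (hlift y u) (vlift v) (c + 4^-1 * gp rho rho) /\
  jet_riem y (vlift v) (hlift y u) (c + 4^-1 * gp rho rho).
Proof.
have [cp hp] := pairing_riesz gm_unit (chr1_linear u u).
pose phi w := gp v (C w v) - 2^-1 * pairing (dg w) v v.
have [cq hq] : exists c, forall w, gp c w = phi w.
  apply: pairing_riesz gm_unit _ => a w w'.
  by rewrite /phi CPl dgP pairingDm pairingZm pairingDr pairingZr; ring.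
(* twice the vertical part of the Christoffel symbol of (u, v) *)
pose psi w := pairing (dg u) v w + gp (C u v) w - gp v (C u w).
have [sg hsg] : exists c, forall w, gp c w = psi w.
  apply: pairing_riesz gm_unit _ => a w w'.
  by rewrite /psi CPr !pairingDr !pairingZr; ring.
exists (pairing (dg u) (C u v) v + gp (C1 u u v) v
        - 2^-1 * pairing (ddg u u) v v - gp (C u v) (C u v)
        + 4^-1 * gp sg sg - gp cp cq) => y rho hrho.
set uu := hlift y u; set vv := vlift v.
have [p p1 pth] := vecth y cp (th1 y uu uu).
have [q q1 qth] := vecth y cq 0.
have [r r1 rth] := vecth y (2^-1 *: rho) (2^-1 *: sg).
have s := pairing_sym _ _ gm_sym.
have ds := pairing_sym _ _ (dg_sym u).
have hp' w : jet_form y p w = jet_chr1 y uu uu w.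
  rewrite /jet_chr1 /jet_form1 !th_hlift !zeroE /= /jet_form p1 pth hp /chr1.
  by field.
have hq' w : jet_form y q w = jet_chr1 y vv vv w.
  rewrite /jet_chr1 /jet_form1 !th_vlift !th1_vlift !th1_at_vlift /= dg0 !zeroE.
  by rewrite /jet_form q1 qth hq !zeroE /phi; field.
have hr' w : jet_form y r w = jet_chr1 y uu vv w.
  have E : th1 y w uu - th1 y uu w = jet_curv u w.1 y - C u (th y w).
    rewrite /jet_curv /th1 /th /= CDr !CNr; apply/rowP => i; rewrite !mxE; ring.
  rewrite /jet_chr1 /jet_form1 !th_vlift !th_hlift !th1_vlift !th1_at_vlift /=.
  rewrite dg0 !zeroE /jet_form r1 rth !pairingZl hrho hsg /psi.
  rewrite (s (th1 y uu w) v).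
  have -> : th1 y w uu = th1 y uu w + (jet_curv u w.1 y - C u (th y w)).
    by rewrite -E addrC subrK.
  rewrite (pairingDr gm) (pairingBr gm v (jet_curv _ _ _)).
  by field.
have hr'' w : jet_form y r w = jet_chr1 y vv uu w.
  rewrite hr' /jet_chr1; congr (_ * _); rewrite [X in X - _]addrC; congr (_ - _).
  rewrite /jet_form1 !th_vlift !th_hlift !th1_vlift !zeroE /=.
  by rewrite s.
split.
- exists p, q, r; split=> //.
  rewrite /jet_form2 /jet_form p1 q1 r1 pth qth rth.
  rewrite !th_hlift !th_vlift !th1_vlift !th2_vlift !th1_at_vlift /=.
  rewrite /th2 /= dg0 ddg0l !ddg0r C20l !C10l !zeroE.
  by rewrite !(pairingZl, pairingZr); field.
- exists q, p, r; split=> //.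
  rewrite /jet_form2 /jet_form p1 q1 r1 pth qth rth.
  rewrite !th_hlift !th_vlift !th1_vlift !th2_vlift !th1_at_vlift /=.
  rewrite /th2 /= dg0 !ddg0l !ddg0r C20r !C10l !zeroE.
  rewrite !(pairingZl, pairingZr) (s cq cp) (ds v) (s v).
  by field.
Qed.

(** By Gauss's equation in a flat fibre only the second fundamental form counts;
    it is given by the covariant derivative of g, which does not involve y. *)
Lemma jet_riem_vv u v : exists c, forall y, jet_riem y (vlift u) (vlift v) c.
Proof.
pose phi a b w := 2^-1 * (gp b (C w a) + gp a (C w b) - pairing (dg w) a b).
have S a b : exists c, forall w, gp c w = phi a b w.
  apply: pairing_riesz gm_unit _ => e w w'.
  by rewrite /phi !CPl dgP pairingDm pairingZm !pairingDr !pairingZr; ring.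
have [cp hp] := S u u; have [cq hq] := S v v; have [cr hr] := S u v.
exists (gp cr cr - gp cp cq) => y.
have [p p1 pth] := vecth y cp 0.
have [q q1 qth] := vecth y cq 0.
have [r r1 rth] := vecth y cr 0.
have chrE a b w : jet_chr1 y (vlift a) (vlift b) w = phi a b w.1.
  rewrite /jet_chr1 /jet_form1 !th_vlift !th1_vlift !th1_at_vlift /= dg0 !zeroE.
  by rewrite /phi; ring.
exists p, q, r; split.
- by move=> w; rewrite chrE /jet_form p1 pth hp !zeroE.
- by move=> w; rewrite chrE /jet_form q1 qth hq !zeroE.
- by move=> w; rewrite chrE /jet_form r1 rth hr !zeroE.
rewrite /jet_form2 /jet_form p1 q1 r1 pth qth rth.
rewrite !th_vlift !th1_vlift !th2_vlift /= ddg0l !zeroE.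
by rewrite !mulr0; ring.
Qed.

End SasakiJet.

(** * The curvature of the total space *)

Lemma sum_split_ord2 (R : realType) m n (T : 'I_(m + n) -> 'I_(m + n) -> R) :
  \sum_k \sum_l T k l =
  (\sum_a \sum_b T (lshift n a) (lshift n b)
   + \sum_a \sum_b T (lshift n a) (rshift m b))
  + (\sum_a \sum_b T (rshift m a) (lshift n b)
   + \sum_a \sum_b T (rshift m a) (rshift m b)).
Proof.
rewrite big_split_ord -!big_split; congr (_ + _);
  by apply: eq_bigr => a _; rewrite big_split_ord.
Qed.

Lemma sum2_split (R : realType) m n (S T : 'I_m -> 'I_n -> R) :
  \sum_a \sum_b (S a b + T a b) = \sum_a \sum_b S a b + \sum_a \sum_b T a b.
Proof. by rewrite -big_split; apply: eq_bigr => a _; rewrite big_split. Qed.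

Lemma sum2_gt0 (R : realType) m n (T : 'I_m -> 'I_n -> R) a b :
  (forall c d, 0 <= T c d) -> 0 < T a b -> 0 < \sum_a \sum_b T a b.
Proof.
move=> T0 Tab; rewrite (bigD1 a)//= (bigD1 b)//= -addrA ltr_wpDr//.
by apply: addr_ge0; apply: sumr_ge0 => // c _; apply: sumr_ge0.
Qed.

Section TotalSpace.
Context {R : realType} {n : nat}.
Local Notation V := 'rV[R]_n.
Local Notation E := 'rV[R]_(n + n).
Variables (U : set V) (g : V -> 'M[R]_n) (Gam : 'I_n -> V -> 'M[R]_n).
Hypotheses (oU : open U) (smooth_g : diff_upto 1 U g).
Hypothesis smooth_Gam : forall k, diff_upto 1 U (Gam k).

Local Notation Cx x := (connection_vec Gam x).
Local Notation C1x x := (fun w u y => connection_vec (dconn Gam w) x u y).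
Local Notation C2x x :=
  (fun w w' u y => connection_vec (dconn (dconn Gam w) w') x u y).
Local Notation dgx x := (fun w => 'D_w g x).
Local Notation ddgx x := (fun w w' => 'D_w' ('D_w g) x).

Definition split_rv (z : E) : V * V := (lsubmx z, rsubmx z).

Let is_derive_rsubmx (z w : E) : is_derive z w (rsubmx : E -> V) (rsubmx w).
Proof.
have d : differentiable (rsubmx : E -> V) z by exact: differentiable_rsubmx.
split; first exact: diff_derivable.
rewrite deriveE//.
by have /= -> := @diff_lin _ _ _ (rsubmx : {linear E -> V}) z (@continuous_rsubmx _ _ _ _).
Qed.

Lemma is_derive_jet_vert (z w : E) (a : V * V) : U (lsubmx z) ->
  is_derive z w (fun z => jet_vert (Cx (lsubmx z)) (rsubmx z) a)
    (jet_vert1 (Cx (lsubmx z)) (C1x (lsubmx z)) (rsubmx z) a (split_rv w)).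
Proof.
move=> Uz.
have dG k : derivable (Gam k) (lsubmx z) (lsubmx w).
  exact/diff_derivable/(smooth_Gam k).1.
have h := is_derive_connection_vec (L := lsubmx) dG (is_derive_cst a.1 z w)
  (is_derive_rsubmx z w).
apply: is_derive_eq (is_deriveD (is_derive_cst a.2 z w) h) _.
by rewrite /jet_vert1 /= connection_vec0l addr0 add0r.
Qed.

Lemma is_derive_jet_vert1 (z w w' : E) (a : V * V) : U (lsubmx z) ->
  is_derive z w' (fun z => jet_vert1 (Cx (lsubmx z)) (C1x (lsubmx z)) (rsubmx z)
      a (split_rv w))
    (jet_vert2 (C1x (lsubmx z)) (C2x (lsubmx z)) (rsubmx z) a (split_rv w)
      (split_rv w')).
Proof.
move=> Uz.
have dG k : derivable (Gam k) (lsubmx z) (lsubmx w').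
  exact/diff_derivable/(smooth_Gam k).1.
have dG1 k : derivable (dconn Gam (lsubmx w) k) (lsubmx z) (lsubmx w').
  exact/diff_derivable/((smooth_Gam k).2 _).1.
have h1 := is_derive_connection_vec (L := lsubmx) dG1 (is_derive_cst a.1 z w')
  (is_derive_rsubmx z w').
have h2 := is_derive_connection_vec (L := lsubmx) dG (is_derive_cst a.1 z w')
  (is_derive_cst (rsubmx w) z w').
apply: is_derive_eq (is_deriveD h1 h2) _.
have E0 (p q r z1 z2 z3 : V) : z1 = 0 -> z2 = 0 -> z3 = 0 ->
  p + z1 + q + (r + z2 + z3) = p + q + r by move=> -> -> ->; rewrite !addr0.
by apply: E0; [exact: connection_vec0l|exact: connection_vec0l
              |exact: connection_vec0r].
Qed.

Let is_derive_g (z w : E) : U (lsubmx z) ->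
  is_derive z w (fun z => g (lsubmx z)) ('D_(lsubmx w) g (lsubmx z)).
Proof.
move=> Uz; apply: (is_derive_comp_linear (L := lsubmx) (f := g)).
exact: is_derive_directional (smooth_g.1 _ Uz).
Qed.

Let is_derive_dg (z w w' : E) : U (lsubmx z) ->
  is_derive z w' (fun z => 'D_(lsubmx w) g (lsubmx z))
    ('D_(lsubmx w') ('D_(lsubmx w) g) (lsubmx z)).
Proof.
move=> Uz; apply: (is_derive_comp_linear (L := lsubmx) (f := 'D_(lsubmx w) g)).
exact: is_derive_directional ((smooth_g.2 _).1 _ Uz).
Qed.

Lemma is_derive_jet_form (z w : E) (a b : V * V) : U (lsubmx z) ->
  is_derive z w (fun z => jet_form (g (lsubmx z)) (Cx (lsubmx z)) (rsubmx z) a b)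
    (jet_form1 (g (lsubmx z)) (dgx (lsubmx z)) (Cx (lsubmx z)) (C1x (lsubmx z))
      (rsubmx z) a b (split_rv w)).
Proof.
move=> Uz; apply: is_deriveD.
  exact: is_derive_pairing_cst (is_derive_g w Uz).
exact: is_derive_pairing (is_derive_g w Uz) (is_derive_jet_vert w a Uz)
  (is_derive_jet_vert w b Uz).
Qed.

Lemma is_derive_jet_form1 (z w w' : E) (a b : V * V) : U (lsubmx z) ->
  is_derive z w' (fun z => jet_form1 (g (lsubmx z)) (dgx (lsubmx z))
      (Cx (lsubmx z)) (C1x (lsubmx z)) (rsubmx z) a b (split_rv w))
    (jet_form2 (g (lsubmx z)) (dgx (lsubmx z)) (ddgx (lsubmx z))
      (Cx (lsubmx z)) (C1x (lsubmx z)) (C2x (lsubmx z)) (rsubmx z) a b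
      (split_rv w) (split_rv w')).
Proof.
move=> Uz.
have dv c := is_derive_jet_vert w' c Uz.
have dv1 c := is_derive_jet_vert1 w w' c Uz.
apply: is_deriveD; first exact: is_derive_pairing_cst (is_derive_dg w w' Uz).
apply: is_deriveD.
  apply: is_deriveD.
    exact: is_derive_pairing (is_derive_dg w w' Uz) (dv a) (dv b).
  exact: is_derive_pairing (is_derive_g w' Uz) (dv1 a) (dv b).
exact: is_derive_pairing (is_derive_g w' Uz) (dv a) (dv1 b).
Qed.

Variable G : E -> 'M[R]_(n + n).
Local Notation UE := [set z : E | U (lsubmx z)].
Hypothesis smooth_G : diff_upto 1 UE G.
Hypothesis G_form : forall z, UE z -> forall a b,
  pairing (G z) a b =
  jet_form (g (lsubmx z)) (Cx (lsubmx z)) (rsubmx z) (split_rv a) (split_rv b).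
Hypothesis G_sym : forall z, UE z -> (G z)^T = G z.
Hypothesis G_unit : forall z, UE z -> G z \in unitmx.
Hypothesis g_sym : forall x, U x -> (g x)^T = g x.
Hypothesis g_unit : forall x, U x -> g x \in unitmx.

Let open_UE : open UE.
Proof. by apply: open_comp => // z _; exact: continuous_lsubmx. Qed.

Let nearUE z : UE z -> \near z, UE z.
Proof. by move=> Uz; exact: open_nbhs_nbhs. Qed.

Let derive_G z w a b : UE z -> pairing ('D_w G z) a b =
  jet_form1 (g (lsubmx z)) (dgx (lsubmx z)) (Cx (lsubmx z)) (C1x (lsubmx z))
    (rsubmx z) (split_rv a) (split_rv b) (split_rv w).
Proof.
move=> Uz.
have [_ <-] := is_derive_pairing_cst a b (is_derive_directional w (smooth_G.1 z Uz)).
have [_ <-] := is_derive_jet_form w (split_rv a) (split_rv b) Uz.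
by apply: near_eq_derive; apply: filterS (nearUE Uz) => y Uy; exact: G_form.
Qed.

Let derive2_G z w w' a b : UE z -> pairing ('D_w' ('D_w G) z) a b =
  jet_form2 (g (lsubmx z)) (dgx (lsubmx z)) (ddgx (lsubmx z))
    (Cx (lsubmx z)) (C1x (lsubmx z)) (C2x (lsubmx z)) (rsubmx z)
    (split_rv a) (split_rv b) (split_rv w) (split_rv w').
Proof.
move=> Uz.
have [_ <-] := is_derive_pairing_cst a b
  (is_derive_directional w' ((smooth_G.2 w).1 z Uz)).
have [_ <-] := is_derive_jet_form1 w w' (split_rv a) (split_rv b) Uz.
by apply: near_eq_derive; apply: filterS (nearUE Uz) => y Uy; exact: derive_G.
Qed.

Let chr1_G z u v w : UE z -> chr1 (fun u => 'D_u G z) u v w =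
  jet_chr1 (g (lsubmx z)) (dgx (lsubmx z)) (Cx (lsubmx z)) (C1x (lsubmx z))
    (rsubmx z) (split_rv u) (split_rv v) (split_rv w).
Proof.
move=> Uz; have E (a1 a2 a3 b1 b2 b3 : R) : a1 = b1 -> a2 = b2 -> a3 = b3 ->
  2^-1 * (a1 + a2 - a3) = 2^-1 * (b1 + b2 - b3) by move=> -> -> ->.
exact: E (derive_G u v w Uz) (derive_G v u w Uz) (derive_G w u v Uz).
Qed.

(** The actual derivatives of G are the ones of the jet, so the algebraic
    curvature is the curvature of G. *)
Lemma riem_jet z u v K : UE z ->
  jet_riem (g (lsubmx z)) (dgx (lsubmx z)) (ddgx (lsubmx z))
    (Cx (lsubmx z)) (C1x (lsubmx z)) (C2x (lsubmx z)) (rsubmx z)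
    (split_rv u) (split_rv v) K -> riem G z u v = K.
Proof.
move=> Uz [p [q [r [hp hq hr ->]]]].
have sE (a : V * V) : split_rv (row_mx a.1 a.2) = a.
  by rewrite /split_rv row_mxKl row_mxKr; case: a.
rewrite (@riemE _ _ G UE open_UE smooth_G G_sym G_unit z u v
  (row_mx p.1 p.2) (row_mx q.1 q.2) (row_mx r.1 r.2) Uz); last first.
- by move=> w; rewrite (G_form Uz) sE hr chr1_G.
- by move=> w; rewrite (G_form Uz) sE hq chr1_G.
- by move=> w; rewrite (G_form Uz) sE hp chr1_G.
rewrite !(G_form Uz) !sE.
have E (a1 a2 a3 b1 b2 b3 c d : R) : a1 = b1 -> a2 = b2 -> a3 = b3 ->
    a1 - 2^-1 * a2 - 2^-1 * a3 + c - d = b1 - 2^-1 * b2 - 2^-1 * b3 + c - d.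
  by move=> -> -> ->.
exact: (E _ _ _ _ _ _ _ _ (derive2_G v u u v Uz) (derive2_G u u v v Uz)
  (derive2_G v v u u Uz)).
Qed.

Variable x : V.
Hypothesis Ux : U x.

Let gm_sym := g_sym Ux.
Let gm_unit := g_unit Ux.
Let dg_sym u : ('D_u g x)^T = 'D_u g x.
Proof. exact: (symD oU smooth_g g_sym). Qed.
Let dgP a u v : 'D_(a *: u + v) g x = a *: 'D_u g x + 'D_v g x :> 'M[R]_n.
Proof. exact: (derive_linear_dir (smooth_g.1 _ Ux) erefl erefl erefl erefl). Qed.
Let derive_dir0 (W : normedModType R) (f : V -> W) : 'D_0 f = cst 0.
Proof. by apply/funext => y; exact: derive0. Qed.
Let ddg0l u : 'D_u ('D_0 g) x = 0 :> 'M[R]_n.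
Proof. by rewrite derive_dir0; exact: derive_cst. Qed.
Let ddg0r u : 'D_0 ('D_u g) x = 0 :> 'M[R]_n.
Proof. exact: derive0. Qed.
Let CPl a u v w : Cx x (a *: u + v) w = a *: Cx x u w + Cx x v w.
Proof. exact: connection_vecPl. Qed.
Let CPr a u v w : Cx x w (a *: u + v) = a *: Cx x w u + Cx x w v.
Proof. exact: connection_vecPr. Qed.
Let C1P1 a u v w y : connection_vec (dconn Gam (a *: u + v)) x w y =
  a *: connection_vec (dconn Gam u) x w y + connection_vec (dconn Gam v) x w y.
Proof.
apply: connection_vec_comb => k.
exact: (derive_linear_dir ((smooth_Gam k).1 _ Ux) erefl erefl erefl erefl).
Qed.
Let C1P2 a u v w y : connection_vec (dconn Gam w) x (a *: u + v) y =
  a *: connection_vec (dconn Gam w) x u y + connection_vec (dconn Gam w) x v y.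
Proof. exact: connection_vecPl. Qed.
Let connection_vec_zero (B : 'I_n -> V -> 'M[R]_n) u v :
  (forall k, B k x = 0) -> connection_vec B x u v = 0.
Proof. by move=> B0; apply/rowP => k; rewrite !mxE B0 pairing0m. Qed.
Let C20l u v y : connection_vec (dconn (dconn Gam 0) u) x v y = 0.
Proof.
apply: connection_vec_zero => k; rewrite /dconn derive_dir0.
exact: derive_cst.
Qed.
Let C20r u v y : connection_vec (dconn (dconn Gam u) 0) x v y = 0.
Proof. by apply: connection_vec_zero => k; exact: derive0. Qed.
Let C20 u v y : connection_vec (dconn (dconn Gam u) v) x 0 y = 0.
Proof. exact: connection_vec0l. Qed.

Let curvE u v y : curvature_at Gam x u v y = jet_curv (Cx x) (C1x x) u v y.
Proof. by rewrite curvature_atE// => k; exact: (smooth_Gam k).1. Qed.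

Definition horizontal (y u : V) : E := row_mx u (- Cx x u y).

Definition vertical (u : V) : E := row_mx 0 u.

Let split_row (a b : V) : split_rv (row_mx a b) = (a, b).
Proof. by rewrite /split_rv row_mxKl row_mxKr. Qed.

Lemma riem_hh u v : exists c, forall y,
  riem G (row_mx x y) (horizontal y u) (horizontal y v) =
  c - 3 / 4 * pairing (g x) (curvature_at Gam x u v y) (curvature_at Gam x u v y).
Proof.
have [c hc] := jet_riem_hh (ddgx x) (C1x x) (C2x x) gm_sym gm_unit dgP CPr u v.
exists c => y; apply: riem_jet; first by rewrite /= row_mxKl.
rewrite !split_row row_mxKl row_mxKr curvE; exact: hc.
Qed.

Lemma riem_hv u v : exists c, forall y rho,
  (forall w, pairing (g x) rho w = pairing (g x) v (curvature_at Gam x u w y)) ->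
  riem G (row_mx x y) (horizontal y u) (vertical v) =
    c + 4^-1 * pairing (g x) rho rho /\
  riem G (row_mx x y) (vertical v) (horizontal y u) =
    c + 4^-1 * pairing (g x) rho rho.
Proof.
have [c hc] := jet_riem_hv (gm := g x) (dg := dgx x) (ddg := ddgx x) (C := Cx x)
  (C1 := C1x x) (C2 := C2x x) gm_sym gm_unit dg_sym dgP ddg0l ddg0r CPl CPr
  C1P1 C1P2 C20l C20r C20 u v.
exists c => y rho hrho.
have [h1 h2] : _ /\ _ := hc y rho (fun w => etrans (hrho w) (congr1 _ (curvE u w y))).
split; apply: riem_jet; rewrite /= ?row_mxKl//.
- by rewrite !split_row row_mxKr; exact: h1.
- by rewrite !split_row row_mxKr; exact: h2.
Qed.

Lemma riem_vv u v : exists c, forall y,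
  riem G (row_mx x y) (vertical u) (vertical v) = c.
Proof.
have [c hc] := jet_riem_vv (gm := g x) (dg := dgx x) (ddg := ddgx x) (C := Cx x)
  (C1 := C1x x) (C2 := C2x x) gm_unit dgP ddg0l CPl C1P1 C1P2 C20 u v.
exists c => y; apply: riem_jet; first by rewrite /= row_mxKl.
rewrite !split_row row_mxKl row_mxKr; exact: hc.
Qed.

Let z y : E := row_mx x y.
Let UEz y : UE (z y). Proof. by rewrite /= row_mxKl. Qed.

Let G_zE y (a b : V * V) : pairing (G (z y)) (row_mx a.1 a.2) (row_mx b.1 b.2) =
  pairing (g x) a.1 b.1
  + pairing (g x) (a.2 + Cx x a.1 y) (b.2 + Cx x b.1 y).
Proof. by rewrite (G_form (UEz y)) !split_row /z row_mxKl row_mxKr. Qed.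

Let G_hh y u v : pairing (G (z y)) (horizontal y u) (horizontal y v) =
  pairing (g x) u v.
Proof.
by rewrite (G_zE y (u, _) (v, _)) /= !addNr pairing0l addr0.
Qed.

Let G_hv y u v : pairing (G (z y)) (horizontal y u) (vertical v) = 0.
Proof.
by rewrite (G_zE y (u, _) (0, _)) /= addNr pairing0l pairing0r addr0.
Qed.

Let G_vh y u v : pairing (G (z y)) (vertical v) (horizontal y u) = 0.
Proof. by rewrite (pairing_sym _ _ (G_sym (UEz y))) G_hv. Qed.

Let G_vv y u v : pairing (G (z y)) (vertical u) (vertical v) =
  pairing (g x) u v.
Proof.
by rewrite (G_zE y (0, _) (0, _)) /= !connection_vec0l !addr0 pairing0l add0r.
Qed.

Variable P : 'M[R]_n.
Hypothesis P_frame : P *m g x *m P^T = 1%:M.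

Let p a : V := row a P.

Let p_orth a b : pairing (g x) (p a) (p b) = (a == b)%:R.
Proof. by rewrite -frame_pairing P_frame mxE. Qed.

Local Notation K := (curvature_at Gam x).

Let dGam k : differentiable (Gam k) x. Proof. exact: (smooth_Gam k).1. Qed.

(** The squared norm of the curvature tensor applied to y. *)
Definition curvature_norm2 (y : V) : R :=
  \sum_a \sum_b pairing (g x) (K (p a) (p b) y) (K (p a) (p b) y).

Let dual_curv u v y : exists rho, forall w,
  pairing (g x) rho w = pairing (g x) v (K u w y).
Proof.
apply: pairing_riesz gm_unit _ => a w w'.
by rewrite (curvature_at_linear2 dGam u y a w w') pairingDr pairingZr.
Qed.

(** Parseval's identity, applied first to rho and then to the curvature. *)
Let sum_dual_curv (rho : 'I_n -> 'I_n -> V) y :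
  (forall a b w, pairing (g x) (rho a b) w = pairing (g x) (p b) (K (p a) w y)) ->
  \sum_a \sum_b pairing (g x) (rho a b) (rho a b) = curvature_norm2 y.
Proof.
move=> hrho; apply: eq_bigr => a _.
under eq_bigr do rewrite (parseval _ P_frame).
rewrite exchange_big; apply: eq_bigr => c _; rewrite (parseval _ P_frame).
apply: eq_bigr => b _; rewrite hrho.
by rewrite (pairing_sym _ _ gm_sym).
Qed.

Definition sasaki_frame y : 'M[R]_(n + n) :=
  col_mx (\matrix_a horizontal y (p a)) (\matrix_a vertical (p a)).

Let row_frame_h y a : row (lshift n a) (sasaki_frame y) = horizontal y (p a).
Proof. by rewrite rowKu rowK. Qed.

Let row_frame_v y a : row (rshift n a) (sasaki_frame y) = vertical (p a).
Proof. by rewrite rowKd rowK. Qed.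

Let sasaki_frameP y :
  sasaki_frame y *m G (z y) *m (sasaki_frame y)^T = 1%:M.
Proof.
apply/matrixP => i j; rewrite frame_pairing mxE.
case: (split_ordP i) => a ->; case: (split_ordP j) => b ->.
- by rewrite !row_frame_h G_hh p_orth eq_lshift.
- by rewrite row_frame_h row_frame_v G_hv eq_lrshift.
- by rewrite row_frame_h row_frame_v G_vh eq_rlshift.
- by rewrite !row_frame_v G_vv p_orth eq_rshift.
Qed.

(** The horizontal planes contribute - 3/4 of the squared norm of the curvature,
    and the mixed planes 1/4 in each of the two orders. *)
Lemma scalar_total : exists c, forall y,
  Defs.scalar G (row_mx x y) = c - 4^-1 * curvature_norm2 y.
Proof.
have [ch hh] := choice (fun ab => riem_hh (p ab.1) (p ab.2)).
have [cm hm] := choice (fun ab => riem_hv (p ab.1) (p ab.2)).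
have [cv hv] := choice (fun ab => riem_vv (p ab.1) (p ab.2)).
exists (\sum_a \sum_b (ch (b, a) + cm (a, b) + (cm (b, a) + cv (b, a)))) => y.
have [rho hrho] := choice (fun ab : 'I_n * 'I_n => dual_curv (p ab.1) (p ab.2) y).
rewrite (scalar_frame _ (sasaki_frameP y)); last first.
  move=> k; exact: (differentiable_levi_civita open_UE smooth_G G_unit).
rewrite sum_split_ord2 -!sum2_split.
pose d a b : R := - (3 / 4 * pairing (g x) (K (p b) (p a) y) (K (p b) (p a) y))
  + (4^-1 * pairing (g x) (rho (a, b)) (rho (a, b))
     + 4^-1 * pairing (g x) (rho (b, a)) (rho (b, a))).
transitivity (\sum_a \sum_b (ch (b, a) + cm (a, b) + (cm (b, a) + cv (b, a))
    + d a b)).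
  apply: eq_bigr => a _; apply: eq_bigr => b _.
  rewrite !row_frame_h !row_frame_v (hh (b, a) y) (hv (b, a) y).
  rewrite (hm (a, b) y (rho (a, b)) (hrho (a, b))).2.
  rewrite (hm (b, a) y (rho (b, a)) (hrho (b, a))).1.
  by rewrite /d; ring.
rewrite sum2_split; congr (_ + _).
rewrite sum2_split sum2_split [X in _ + (_ + X)]exchange_big /=.
have -> : \sum_a \sum_b 4^-1 * pairing (g x) (rho (a, b)) (rho (a, b)) =
    4^-1 * curvature_norm2 y.
  rewrite -(sum_dual_curv (rho := fun a b => rho (a, b)))//.
  by rewrite mulr_sumr; apply: eq_bigr => a _; rewrite mulr_sumr.
have -> : \sum_a \sum_b - (3 / 4 * pairing (g x) (K (p b) (p a) y) (K (p b) (p a) y))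
    = - (3 / 4 * curvature_norm2 y).
  rewrite exchange_big /curvature_norm2 mulr_sumr -sumrN; apply: eq_bigr => a _.
  by rewrite mulr_sumr -sumrN.
by field.
Qed.

Lemma curvature_norm2Z t y : curvature_norm2 (t *: y) = t ^+ 2 * curvature_norm2 y.
Proof.
rewrite /curvature_norm2 mulr_sumr; apply: eq_bigr => a _.
rewrite mulr_sumr; apply: eq_bigr => b _.
by rewrite curvature_at_scale3// pairingZl pairingZr mulrA expr2.
Qed.

Hypothesis g_pos : forall u, u != 0 -> 0 < pairing (g x) u u.

Let g_ge0 u : 0 <= pairing (g x) u u.
Proof.
by have [->|/g_pos/ltW//] := eqVneq u 0; rewrite pairing0l.
Qed.

(** By bilinearity in the first two arguments; a and b are then distinct, so the
    lifts of the frame vectors span planes with Gram determinant 1. *)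
Lemma curvature_frame_neq0 u v y : K u v y != 0 ->
  exists a b, K (p a) (p b) y != 0.
Proof.
move=> Kuv; apply: contrapT => h; case/negP: Kuv; apply/eqP.
have K0 a b : K (p a) (p b) y = 0.
  by apply/eqP/negPn/negP => Kab; apply: h; exists a, b.
have PE w : w = \sum_a (w *m invmx P) 0 a *: p a.
  rewrite -mulmx_sum_row mulmxKV//.
  by move: P_frame; rewrite -mulmxA => /mulmx1_unit[].
rewrite (PE u) (linear_comb_sum _ _ (curvature_at_linear1 dGam v y)).
rewrite big1// => a _.
rewrite (PE v) (linear_comb_sum _ _ (curvature_at_linear2 dGam (p a) y)).
by rewrite big1 ?scaler0// => b _; rewrite K0 scaler0.
Qed.

Lemma curvature_norm2_gt0 u v y : K u v y != 0 -> 0 < curvature_norm2 y.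
Proof.
move=> /curvature_frame_neq0[a [b Kab]].
apply: (sum2_gt0 (a := a) (b := b)) => [c d|]; [exact: g_ge0|exact: g_pos].
Qed.

Let sectional_orth y (u v : E) :
  pairing (G (z y)) u u = 1 -> pairing (G (z y)) v v = 1 ->
  pairing (G (z y)) u v = 0 ->
  row_free (col_mx u v) /\ sectional G (z y) u v = riem G (z y) u v.
Proof.
move=> uu vv uv; split; last first.
  by rewrite /sectional uu vv uv expr0n subr0 mulr1 divr1.
have vu : pairing (G (z y)) v u = 0 by rewrite (pairing_sym _ _ (G_sym (UEz y))).
apply/row_freeP; exists (G (z y) *m (col_mx u v)^T); rewrite mulmxA.
apply/matrixP => i j; rewrite frame_pairing mxE.
case: (split_ordP i) => a ->; case: (split_ordP j) => b ->;
  rewrite ?rowKu ?rowKd !ord1 ?row_id ?eq_lrshift ?eq_rlshift ?eqxx.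
- by rewrite uu.
- by rewrite uv.
- by rewrite vu.
- by rewrite vv.
Qed.

Lemma sectional_horizontal u v y : K u v y != 0 ->
  exists c q, 0 < q /\ forall t, exists w1 w2, row_free (col_mx w1 w2) /\
    sectional G (row_mx x (t *: y)) w1 w2 = c - t ^+ 2 * q.
Proof.
move=> /curvature_frame_neq0[a [b Kab]].
have ab : a != b.
  by apply: contraNneq Kab => ->; rewrite curvature_at_self.
have [c hc] := riem_hh (p a) (p b).
exists c, (3 / 4 * pairing (g x) (K (p a) (p b) y) (K (p a) (p b) y)).
split; first by rewrite mulr_gt0 ?g_pos// divr_gt0 ?ltr0n.
move=> t; exists (horizontal (t *: y) (p a)), (horizontal (t *: y) (p b)).
have [|||rf ->] := @sectional_orth (t *: y) (horizontal (t *: y) (p a))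
  (horizontal (t *: y) (p b)); rewrite ?G_hh ?p_orth ?eqxx ?(negPf ab)//.
split=> //; rewrite hc curvature_at_scale3// pairingZl pairingZr; ring.
Qed.

Lemma sectional_mixed u v y : K u v y != 0 ->
  exists c q, 0 < q /\ forall t, exists w1 w2, row_free (col_mx w1 w2) /\
    sectional G (row_mx x (t *: y)) w1 w2 = c + t ^+ 2 * q.
Proof.
move=> /curvature_frame_neq0[a [c Kac]].
have [b Kb] : exists b, pairing (g x) (p b) (K (p a) (p c) y) != 0.
  apply: contrapT => h; move: (g_pos Kac); rewrite (parseval _ P_frame) big1 ?ltxx//.
  move=> b _; apply/eqP; rewrite sqrf_eq0 (pairing_sym _ _ gm_sym).
  by apply/negPn/negP => hb; apply: h; exists b.
have [rho hrho] := dual_curv (p a) (p b) y.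
have rho0 : rho != 0.
  by apply: contraNneq Kb => r0; rewrite -hrho r0 pairing0l.
have [k hk] := riem_hv (p a) (p b).
exists k, (4^-1 * pairing (g x) rho rho).
split; first by rewrite mulr_gt0 ?g_pos// invr_gt0 ltr0n.
move=> t; exists (horizontal (t *: y) (p a)), (vertical (p b)).
have [|||rf ->] := @sectional_orth (t *: y) (horizontal (t *: y) (p a))
  (vertical (p b)); rewrite ?G_hh ?G_vv ?G_hv ?p_orth ?eqxx//.
split=> //; rewrite (hk (t *: y) (t *: rho) _).1; last first.
  by move=> w; rewrite pairingZl hrho curvature_at_scale3// pairingZr.
by rewrite pairingZl pairingZr; ring.
Qed.

End TotalSpace.

(** * Lifts of vectors and the Sasakian metric in a chart *)

Section Lifts.
Context {R : realType} {n : nat} {N : smooth_atlas R n}.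
Implicit Types (xi : tangent N) (X : 'rV[R]_n).

Lemma is_derive_row_mx m (a b : R -> 'rV[R]_m) (t : R) da db :
  is_derive t (1 : R) (fun s => row_mx (a s) (b s)) (row_mx da db) ->
  is_derive t (1 : R) a da /\ is_derive t (1 : R) b db.
Proof.
move=> /is_derive_mxP h; split; apply/is_derive_mxP => i j.
  have := h i (lshift m j); rewrite row_mxEl.
  by under eq_fun do rewrite row_mxEl.
have := h i (rshift m j); rewrite row_mxEr.
by under eq_fun do rewrite row_mxEr.
Qed.

Lemma vertical_liftE i xi X : vertical_lift i xi X = row_mx 0 X.
Proof.
rewrite /vertical_lift derive1E; apply: derive_val.
apply/is_derive_mxP => a j; rewrite ord1; case: (split_ordP j) => k ->.
  under eq_fun do rewrite row_mxEl.
  by rewrite row_mxEl mxE; exact: is_derive_cst.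
under eq_fun do rewrite row_mxEr !mxE.
rewrite row_mxEr.
have h := is_deriveD (is_derive_cst (Defs.comp xi i 0 k) (0 : R) 1)
  (is_deriveM (is_derive_id (0 : R) 1) (is_derive_cst (X 0 k) (0 : R) 1)).
apply: is_derive_eq h _.
by rewrite /= scaler0 !add0r /GRing.scale /= mulr1.
Qed.

(** The transported vector satisfies y' + Gam (x', y) = 0 at time 0, which is all
    that the velocity of the lifted curve retains of it. *)
Lemma horizontal_liftE (nabla : connection N) i xi X w :
  horizontal_lift nabla i xi X w ->
  w = row_mx X (- connection_vec (nabla i) (Defs.coord i (base xi)) X (Defs.comp xi i)).
Proof.
move=> [e e0 [c /=]] [_ sz _ par [c0 x1 z1]].
have b0 : ball (0 : R) e 0 by exact: ballxx.
have dz : is_derive (0 : R) (1 : R) (fun t => tcoord i (c t)) (row_mx (lsubmx w) (rsubmx w)).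
  rewrite hsubmxK -z1 derive1E; apply: is_derive_directional.
  exact: (sz 0%N).1.
have [dx dy] := is_derive_row_mx dz.
have xE : lsubmx w = X by rewrite -x1 derive1E; case: dx.
have := par 0 b0; rewrite /cov_along x1 c0 derive1E.
case: dy => _ -> /eqP; rewrite addr_eq0 => /eqP yE.
by rewrite -[w]hsubmxK xE yE.
Qed.

End Lifts.

Section Sasakian.
Context {R : realType} {n : nat} {N : smooth_atlas R n}.
Variables (g : metric N) (nabla : connection N) (gt : metric (tangent_bundle N)).

Lemma tcoord_tparam (i : chart N) (z : 'rV[R]_(n + n)) :
  chart_image i (lsubmx z) -> tdom i (tparam i z) /\ tcoord i (tparam i z) = z.
Proof.
move=> /chart_imageP[ip pz]; split=> //.
by rewrite /tcoord /= /mk_comp (asboolT (conj ip ip)) dtrans_id// pz hsubmxK.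
Qed.

(** Every vector is the horizontal lift of its base component plus the vertical
    lift of its vertical part, and the metric is prescribed on such lifts. *)
Lemma sasakian_form (i : chart N) z a b :
  sasakian g nabla gt -> chart_image i (lsubmx z) ->
  pairing (gt i z) a b =
  jet_form (g i (lsubmx z)) (connection_vec (nabla i) (lsubmx z)) (rsubmx z)
    (split_rv a) (split_rv b).
Proof.
move=> sas Uz; have [dz zE] := tcoord_tparam Uz.
have [hl hlP hG] := sas i (tparam i z) dz.
have xE : Defs.coord i (base (tparam i z)) = lsubmx z.
  by rewrite -[in RHS]zE row_mxKl.
have yE : Defs.comp (tparam i z) i = rsubmx z by rewrite -[in RHS]zE row_mxKr.
rewrite zE xE in hG.
have decomp w : w = hl (lsubmx w) + vertical_lift i (tparam i z)
    (jet_vert (connection_vec (nabla i) (lsubmx z)) (rsubmx z) (split_rv w)).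
  rewrite (horizontal_liftE (hlP _)) vertical_liftE add_row_mx addr0 xE yE.
  by rewrite /jet_vert /= addrCA addNr addr0 hsubmxK.
have sG : (gt i z)^T = gt i z.
  by have := gmx_sym gt (i := i) (p := tparam i z) dz; rewrite /= zE.
rewrite [in LHS](decomp a) [in LHS](decomp b).
rewrite pairingDl !pairingDr.
have hh X Y : pairing (gt i z) (hl X) (hl Y) = pairing (g i (lsubmx z)) X Y.
  by case: (hG X Y).
have vv X Y : pairing (gt i z) (vertical_lift i (tparam i z) X)
    (vertical_lift i (tparam i z) Y) = pairing (g i (lsubmx z)) X Y.
  by case: (hG X Y).
have vh X Y : pairing (gt i z) (vertical_lift i (tparam i z) X) (hl Y) = 0.
  by case: (hG X Y).
by rewrite hh vv vh (pairing_sym _ _ sG) vh addr0 add0r.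
Qed.

Lemma gmx_symU i x : chart_image i x -> (g i x)^T = g i x.
Proof. by move=> [p ip <-]; exact: gmx_sym. Qed.

Lemma gmx_posU i x u : chart_image i x -> u != 0 -> 0 < pairing (g i x) u u.
Proof. by move=> [p ip <-]; exact: gmx_pos. Qed.

End Sasakian.

(** * Unboundedness of the curvatures *)

Lemma quadratic_unbounded (R : realFieldType) (c q m : R) : 0 < q ->
  exists t, c - t ^+ 2 * q < m.
Proof.
move=> q0; exists (1 + `|c - m| / q).
have a0 : 0 <= `|c - m| / q by rewrite divr_ge0// ltW.
have : c - m <= `|c - m| by exact: ler_norm.
rewrite -[X in _ <= X](divfK (lt0r_neq0 q0)).
set s := `|c - m| / q in a0 *; move=> cm.
by have := mulr_ge0 a0 (ltW q0); have := mulr_ge0 (mulr_ge0 a0 a0) (ltW q0); lra.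
Qed.

Theorem theorem2p17 (R : realType) (n : nat) (M : manifold R n)
    (g : metric M) (nabla : connection M) (gt : metric (tangent_bundle M)) :
  statistical g nabla -> sasakian g nabla gt -> ~ flat nabla ->
  (~ has_ubound (sectional_curvatures gt) /\
   ~ has_lbound (sectional_curvatures gt)) /\
  ~ has_lbound (scalar_curvatures gt).
Proof.
move=> _ sas nflat.
have [i [p [u [v [w [ip Kuvw]]]]]] : exists i p u v w, dom i p /\
    curvature_at (nabla i) (Defs.coord i p) u v w != 0.
  apply: contrapT => h; apply: nflat => i p u v w ip.
  apply/eqP/negPn/negP => K; apply: h; by exists i, p, u, v, w.
set x := Defs.coord i p in Kuvw.
pose U : set 'rV[R]_n := chart_image i.
have Ux : U x by exists p.
have oU : open U by exact: open_chart_image.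
have sg : diff_upto 1 U (g i) := gmx_smooth g i 1.
have sGam k : diff_upto 1 U (nabla i k) := chr_smooth nabla i k 1.
have UE z : U (lsubmx z) -> chart_image (N := tangent_bundle M) i z.
  by move=> /tcoord_tparam[dz zE]; exists (tparam i z).
have sG : diff_upto 1 [set z | U (lsubmx z)] (gt i).
  by apply: diff_upto_sub (gmx_smooth gt i 1) => z; exact: UE.
have Gform z (Uz : U (lsubmx z)) a b := sasakian_form a b sas Uz.
have Gsym z (Uz : U (lsubmx z)) := gmx_symU gt (UE z Uz).
have Gunit z (Uz : U (lsubmx z)) : gt i z \in unitmx.
  by apply: posdef_unit => a; exact: gmx_posU (UE z Uz).
have gsym y (Uy : U y) := gmx_symU g Uy.
have gunit y (Uy : U y) : g i y \in unitmx.
  by apply: posdef_unit => a; exact: gmx_posU Uy.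
have gpos a : a != 0 -> 0 < pairing (g i x) a a by exact: gmx_posU Ux.
have [P PgP] := orthonormal_frame (gsym x Ux) gpos.
have tUE t : chart_image (N := tangent_bundle M) i (row_mx x (t *: w)).
  by apply: UE; rewrite row_mxKl.
have sec t a b : row_free (col_mx a b) ->
    sectional_curvatures gt (sectional (gt i) (row_mx x (t *: w)) a b).
  move=> rf; have [q iq <-] := tUE t.
  by exists i, q, a, b.
split; [split|].
- move=> [m hm].
  have [c [q [q0 hq]]] := sectional_mixed oU sg sGam sG Gform Gsym Gunit gsym
    gunit Ux PgP gpos Kuvw.
  have [t ht] := quadratic_unbounded (- c) (- m) q0.
  have [a [b [rf ab]]] := hq t.
  by have := hm _ (sec t a b rf); rewrite ab; lra.
- move=> [m hm].
  have [c [q [q0 hq]]] := sectional_horizontal oU sg sGam sG Gform Gsym Gunit gsym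
    gunit Ux PgP gpos Kuvw.
  have [t ht] := quadratic_unbounded c m q0.
  have [a [b [rf ab]]] := hq t.
  by have := hm _ (sec t a b rf); rewrite ab; lra.
- move=> [m hm].
  have [c hc] := scalar_total oU sg sGam sG Gform Gsym Gunit gsym
    gunit Ux PgP.
  have n0 := curvature_norm2_gt0 sGam Ux PgP gpos Kuvw.
  have q0 : 0 < 4^-1 * curvature_norm2 (g i) (nabla i) x P w.
    by rewrite mulr_gt0 // invr_gt0 ltr0n.
  have [t ht] := quadratic_unbounded c m q0.
  have [q iq qE] := tUE t.
  have := hm _ (ex_intro _ i (ex_intro _ q (conj iq erefl))).
  by rewrite qE hc (curvature_norm2Z _ sGam Ux); lra.
Qed.
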